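(* Let $\sigma>0$, $\delta>0$, let $V$ be a weight, let $\lambda:(-\sigma,\sigma)\to\mathbb{C}$ be a bounded continuous function with $\lambda(t)\equiv1$ on $(-\epsilon,\epsilon)$ for some $0<\epsilon<\sigma$, and let $\Lambda x=\int_{|t|<\sigma}\lambda(t)\,dE(t)x$. Then for every $x\in H$ such that $x\ne U_tx$ for some $t\in\mathbb{R}$, $$\|x-\Lambda x\|^2\le\max\left\{\sup_{|t|<\sigma}\frac{|1-\lambda(t)|^2}{\mathcal{H}(V,\delta,\sigma)},\ \frac1{\mathcal{G}(V,\delta,\sigma)}\right\}\omega_\varphi(x;L_{2,V}([0,\delta]))^2.\qquad(\mathrm{A})$$ In particular, for the best approximation of $x\in H$ by the subspace $W_\sigma$, $$E_\sigma(x)^2=\left\|x-\int_{|t|<\sigma}dE(t)x\right\|^2\le\frac1{\mathcal{G}(V,\delta,\sigma)}\,\omega_\varphi(x;L_{2,V}([0,\delta]))^2.\qquad(\mathrm{B})$$ If the resolution of the identity is such that $E([t,t+\varepsilon])\ne0$ for arbitrary $t\in\mathbb{R}$ and $\varepsilon>0$, then inequalities (A) and (B) are sharp.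
   Context: $H$ is a complex Hilbert space with scalar product $(\cdot,\cdot)$ and norm $\|\cdot\|$. $E$ is a resolution of the identity on the Borel $\sigma$-algebra of $\mathbb{R}$ in $H$: to each Borel set $\beta$ is assigned a projection operator $E(\beta)$ in $H$, with $E(\emptyset)=0$, $E(\mathbb{R})=I$, and $E(\bigcup_j\beta_j)=\sum_jE(\beta_j)$ for every sequence of pairwise disjoint Borel sets $\beta_j$. $dE(t)$ denotes integration with respect to this projection-valued measure, and $U_tx=\int_{-\infty}^{\infty}e^{ist}\,dE(s)x$ for $t\in\mathbb{R}$. Put $W_\sigma=\{\int_{|t|<\sigma}dE(t)g: g\in H\}$ and $E_\sigma(x)=\inf_{h\in W_\sigma}\|x-h\|$. $\Phi$ is the set of continuous nonnegative $2\pi$-periodic functions $\psi$ on $\mathbb{R}$ with nowhere dense zero set and $\psi(0)=0$. $\varphi:\mathbb{C}\to\mathbb{C}$ is a continuous function such that $\psi(t):=|\varphi(e^{it})|^2$ belongs to $\Phi$. For $x\in H$, $t\in\mathbb{R}$ put $\Delta_t^\varphi x=\int_{-\infty}^{\infty}\varphi(e^{its})\,dE(s)x$. A weight is a nonnegative integrable function $V$ on $[0,1]$ that is nonzero on a set of full measure, normalized by $\int_0^1V(t)\,dt=1$. Put $$\omega_\varphi(x;L_{2,V}([0,\delta]))=\left(\frac1\delta\int_0^\delta\|\Delta_t^\varphi x\|^2\,V\!\left(\frac t\delta\right)dt\right)^{1/2},\qquad \Gamma(V;t)=\int_0^1\psi(ts)V(s)\,ds,$$ $$\mathcal{H}(V,\delta,\sigma)=\inf_{|t|\le\sigma}\Gamma(V;\delta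 t),\qquad \mathcal{G}(V,\delta,\sigma)=\inf_{|t|\ge\sigma}\Gamma(V;\delta t).$$ The convention $0/0=0$ is used.
   Formalization: Since ψ(0)=0, H(V,δ,σ)=0, so (A) has constant +∞ unless λ≡1 and is not sharp for fixed λ. Sharpness of (A) is instead proved over all λ with the same sup|1−λ|, and, for each λ, for the stronger inequality (also proved) with Γ(V;δt) in place of H. *)

(* Defs.v *)
From HB Require Import structures.
From mathcomp Require Import all_boot all_order all_algebra.
From mathcomp Require Import complex.
From mathcomp Require Import all_classical all_reals all_analysis.

Set Implicit Arguments.
Unset Strict Implicit.
Unset Printing Implicit Defensive.

Import Order.TTheory GRing.Theory Num.Theory.
Import numFieldNormedType.Exports.

Local Open Scope classical_set_scope.
Local Open Scope ring_scope.

(* e^{it} *)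
Definition cexp (R : realType) (t : R) : R[i] := Complex (cos t) (sin t).

(* The norm of a normed space over R[i] takes its values in R[i] (as a
   nonnegative real element); rnorm is the same number as an element of R. *)
Definition rnorm (R : realType) (V : normedZmodType R[i]) (x : V) : R :=
  complex.Re `|x|.

Section spectral.
Variables (R : realType) (H : completeNormedModType R[i]).
Implicit Types (E : set R -> H -> H) (D : set R) (f : R -> R[i]).

Definition orthogonal_projection (dot : {dot H for Num.conj}) (P : H -> H) :=
  [/\ linear P, forall x, P (P x) = P x & forall x y, dot (P x) y = dot x (P y)].

(* Countable additivity is in the strong operator topology. *)
Definition resolution_of_identity (dot : {dot H for Num.conj}) E :=
  [/\ forall B : set R, measurable B -> orthogonal_projection dot (E B),
      forall x, E set0 x = 0,
      forall x, E [set: R] x = x &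
      forall F : (set R)^nat, (forall j, measurable (F j)) -> trivIset setT F ->
        forall x, (fun n => \sum_(j < n) E (F j) x) @ \oo -->
                  E (\bigcup_j F j) x].

Definition simple_fun f :=
  finite_set (range f) /\ forall c, measurable (f @^-1` [set c]).

Definition simple_spectral_integral E D f x : H :=
  \sum_(c \in range f) c *: E (D `&` f @^-1` [set c]) x.

(* y = \int_D f dE x, for a bounded Borel function f on D: the limit of the
   integrals of simple functions converging to f uniformly on D. *)
Definition is_spectral_integral E D f x (y : H) :=
  exists s : nat -> R -> R[i],
    [/\ forall n, simple_fun (s n),
        forall e : R, 0 < e ->
          \forall n \near \oo, forall t, D t -> rnorm (s n t - f t) < e &
        (fun n => simple_spectral_integral E D (s n) x) @ \oo --> y].

Definition spectral_integral E D f x : H :=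
  xget 0 [set y | is_spectral_integral E D f x y].

Definition unitary_group E (t : R) x : H :=
  spectral_integral E setT (fun s => cexp (s * t)) x.

Definition moved E x := exists t, x <> unitary_group E t x.

Definition W_space E (sigma : R) : set H :=
  range (fun g => spectral_integral E `]- sigma, sigma[ (fun=> 1) g).

Definition best_approx E (sigma : R) x : R :=
  inf [set rnorm (x - h) | h in W_space E sigma].

Definition multiplier_op E (sigma : R) (lambda : R -> R[i]) x : H :=
  spectral_integral E `]- sigma, sigma[ lambda x.

Definition gen_diff E (phi : R[i] -> R[i]) (t : R) x : H :=
  spectral_integral E setT (fun s => phi (cexp (t * s))) x.

Definition gen_modulus E (phi : R[i] -> R[i]) (V : R -> R) (delta : R) x : R :=
  Num.sqrt (delta^-1 * \int[lebesgue_measure]_(t in `[0, delta])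
              (rnorm (gen_diff E phi t x) ^+ 2 * V (t / delta))).

End spectral.

Section moduli.
Variable R : realType.
Implicit Types (psi V : R -> R) (delta sigma : R).

Definition class_Phi psi :=
  [/\ continuous psi, forall t, 0 <= psi t, periodic psi (pi *+ 2),
      interior (closure [set t | psi t = 0]) = set0 & psi 0 = 0].

Definition psi_of (phi : R[i] -> R[i]) (t : R) : R := rnorm (phi (cexp t)) ^+ 2.

Definition weight V :=
  [/\ forall t, t \in `[0, 1] -> 0 <= V t,
      lebesgue_measure.-integrable `[0, 1] (EFin \o V),
      {ae lebesgue_measure, forall t, t \in `[0, 1] -> V t != 0} &
      \int[lebesgue_measure]_(t in `[0, 1]) V t = 1].

Definition Gamma psi V (t : R) : R :=
  \int[lebesgue_measure]_(s in `[0, 1]) (psi (t * s) * V s).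

Definition calH psi V delta sigma : R :=
  inf [set Gamma psi V (delta * t) | t in [set t | `|t| <= sigma]].

Definition calG psi V delta sigma : R :=
  inf [set Gamma psi V (delta * t) | t in [set t | sigma <= `|t|]].

Definition constB psi V delta sigma : \bar R :=
  (1 / (calG psi V delta sigma)%:E)%E.

(* The division of \bar R satisfies 0 / 0 = 0 and a / 0 = +oo for a > 0. Since
   psi 0 = 0 gives Gamma psi V 0 = 0, calH is always 0 and constA is +oo unless
   lambda = 1 on ]-sigma, sigma[. *)
Definition constA psi V delta sigma (lambda : R -> R[i]) : \bar R :=
  maxe (ereal_sup [set ((rnorm (1 - lambda t) ^+ 2)%:E
                          / (calH psi V delta sigma)%:E)%E
                  | t in `]- sigma, sigma[])
       (constB psi V delta sigma).

(* constA with Gamma psi V (delta * t) instead of its infimum over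
   [-sigma, sigma]; it is finite and at most constA. *)
Definition constA_pointwise psi V delta sigma (lambda : R -> R[i]) : \bar R :=
  maxe (ereal_sup [set ((rnorm (1 - lambda t) ^+ 2)%:E
                          / (Gamma psi V (delta * t))%:E)%E
                  | t in `]- sigma, sigma[])
       (constB psi V delta sigma).

Definition deviation sigma (lambda : R -> R[i]) : R :=
  sup [set rnorm (1 - lambda t) | t in `]- sigma, sigma[].

(* lambda is only meaningful on ]-sigma, sigma[; it is total for convenience. *)
Definition multiplier sigma (lambda : R -> R[i]) :=
  [/\ {within `]- sigma, sigma[, continuous (lambda : R -> R[i]^o)},
      exists M : R, forall t, `|t| < sigma -> rnorm (lambda t) <= M &
      exists e : R, [/\ 0 < e, e < sigma & forall t, `|t| < e -> lambda t = 1]].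

End moduli.

Section sharpness.
Variables (R : realType) (H : completeNormedModType R[i]).
Implicit Types (E : set R -> H -> H) (phi : R[i] -> R[i]) (V : R -> R).
Implicit Types (delta sigma : R) (lambda mu : R -> R[i]).

(* No real c < C is valid in
     |x - Lambda x|^2 <= c * omega^2  (x moved)
   for the operator Lambda of the given lambda. *)
Definition sharp_for_multiplier E phi V delta sigma lambda (C : \bar R) :=
  forall c : R,
    (forall x, moved E x ->
       rnorm (x - multiplier_op E sigma lambda x) ^+ 2 <=
         c * gen_modulus E phi V delta x ^+ 2) ->
    (C <= c%:E)%E.

(* No real c < C is valid in the same inequality for all multipliers with the
   same value of sup |1 - lambda|, the only feature of lambda that constA
   depends on. *)
Definition sharp_for_deviation E phi V delta sigma lambda (C : \bar R) :=
  forall c : R,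
    (forall mu, multiplier sigma mu ->
       deviation sigma mu = deviation sigma lambda ->
       forall x, moved E x ->
         rnorm (x - multiplier_op E sigma mu x) ^+ 2 <=
           c * gen_modulus E phi V delta x ^+ 2) ->
    (C <= c%:E)%E.

Definition sharp_for_best_approx E phi V delta sigma (C : \bar R) :=
  forall c : R,
    (forall x, moved E x ->
       best_approx E sigma x ^+ 2 <= c * gen_modulus E phi V delta x ^+ 2) ->
    (C <= c%:E)%E.

End sharpness.

(* Main.v *)
(* For x in H let nu_x(B) = |E(B) x|^2, a finite Borel measure. A spectral integral
   y of f over D satisfies |a E(B) x - y|^2 = int |a 1_B - f 1_D|^2 d nu_x, so
   |x - Lambda x|^2 = int |1 - lambda 1_]-sigma, sigma[|^2 d nu_x, and by Tonelli
   and t -> t / delta also omega^2 = int Gamma(V; delta s) d nu_x(s). The upper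
   bounds are thus pointwise inequalities between integrands; when a constant is
   +oo one needs omega > 0, which holds since Gamma(V; s) > 0 for s <> 0 and a
   measure nu_x carried by {0} makes x a fixed point of every U_t. Sharpness is
   tested on vectors whose measure is carried by a short interval [t, t + e]. *)

Require Import Defs.
From HB Require Import structures.
From mathcomp Require Import all_boot all_order all_algebra.
From mathcomp Require Import complex finmap ring lra zify.
From mathcomp Require Import all_classical all_reals all_analysis measurable_realfun.

Set Implicit Arguments.
Unset Strict Implicit.
Unset Printing Implicit Defensive.

Import Order.TTheory GRing.Theory Num.Theory.
Import numFieldNormedType.Exports.

Local Open Scope classical_set_scope.
Local Open Scope ring_scope.
Local Open Scope complex_scope.
Local Notation Re := complex.Re.
Local Notation Im := complex.Im.


(** A spectral integral is a chosen limit with default value 0, so its formulas wait for the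
    existence of such a limit; and the product rule for E(A) E(B) has to be derived from additivity
    before nu_x becomes usable. The reference term a E(B) x of the isometry has three uses: B = R
    gives the distance from x, a = 0 the norm of the integral, B = D identifies the integral of 1
    over D with E(D) x. Inequality (B) is the case lambda = 1 of what is proved for (A). For
    sharpness, a real c valid for all moved vectors forces the error density at t to be at most c
    Gamma(V; delta t) for every t <> 0. The point 0 is out of reach, since vectors carried by {0}
    are fixed, but lambda(0) = 1 and Gamma(V; 0) = 0 make it harmless. As [calH] is 0, the constant
    of (A) is infinite unless lambda = 1 on the interval, while [constA_pointwise] may be smaller;
    sharpness of the former is therefore sought among all multipliers of equal deviation, some of
    which deviate from 1 arbitrarily close to 0. *)

(** * Real-valued norms over the complex field *)

Section rnorm_theory.
Variable R : realType.

Lemma rnormE (V : normedZmodType R[i]) (x : V) : `|x| = (rnorm x)%:C.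
Proof. by rewrite /rnorm RRe_real// ger0_real. Qed.

Lemma rnorm_ge0 (V : normedZmodType R[i]) (x : V) : 0 <= rnorm x.
Proof. by rewrite -ler0c -rnormE. Qed.

Lemma rnorm0 (V : normedZmodType R[i]) : rnorm (0 : V) = 0.
Proof. by rewrite /rnorm normr0. Qed.

Lemma rnorm_eq0 (V : normedZmodType R[i]) (x : V) : (rnorm x == 0) = (x == 0).
Proof. by rewrite -[RHS]normr_eq0 rnormE -(inj_eq (@complexI R)). Qed.

Lemma rnormN (V : normedZmodType R[i]) (x : V) : rnorm (- x) = rnorm x.
Proof. by rewrite /rnorm normrN. Qed.

Lemma rnormB (V : normedZmodType R[i]) (x y : V) : rnorm (x - y) = rnorm (y - x).
Proof. by rewrite /rnorm distrC. Qed.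

Lemma rnormD (V : normedZmodType R[i]) (x y : V) :
  rnorm (x + y) <= rnorm x + rnorm y.
Proof. by rewrite -lecR rmorphD /= -!rnormE ler_normD. Qed.

Lemma rnormBD (V : normedZmodType R[i]) (z x y : V) :
  rnorm (x - y) <= rnorm (x - z) + rnorm (z - y).
Proof. by rewrite -lecR rmorphD /= -!rnormE ler_distD. Qed.

Lemma ler_dist_rnorm (V : normedZmodType R[i]) (x y : V) :
  `|rnorm x - rnorm y| <= rnorm (x - y).
Proof.
have := rnormD (x - y) y; have := rnormD (y - x) x.
by rewrite !subrK (rnormB y) ler_norml => ? ?; apply/andP; split; lra.
Qed.

Lemma rnormM (x y : R[i]) : rnorm (x * y) = rnorm x * rnorm y.
Proof. by apply: complexI; rewrite rmorphM /= -!rnormE normrM. Qed.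

Lemma rnorm1 : rnorm (1 : R[i]) = 1.
Proof. by rewrite /rnorm normr1. Qed.

Lemma rnorm_real (r : R) : rnorm (r%:C) = `|r|.
Proof. by rewrite /rnorm normc_def /= expr0n addr0 sqrtr_sqr. Qed.

Lemma rnorm_sqr (z : R[i]) : rnorm z ^+ 2 = Re z ^+ 2 + Im z ^+ 2.
Proof. by apply: complexI; rewrite add_Re2_Im2 rmorphXn /= -rnormE. Qed.

Lemma rnorm_sqrE (z : R[i]) : rnorm z ^+ 2 = Re (z * Num.conj z).
Proof. by rewrite -normCK rnormE -rmorphXn. Qed.

Lemma ler_Re_rnorm (z : R[i]) : `|Re z| <= rnorm z.
Proof. by rewrite -lecR -rnormE normc_ge_Re. Qed.

Lemma ler_Im_rnorm (z : R[i]) : `|Im z| <= rnorm z.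
Proof.
rewrite -(ler_pXn2r (n := 2)) ?nnegrE ?rnorm_ge0// rnorm_sqr real_normK ?num_real//.
by rewrite lerDr sqr_ge0.
Qed.

Lemma ler_rnorm_ReIm (z : R[i]) : rnorm z <= `|Re z| + `|Im z|.
Proof.
rewrite -(ler_pXn2r (n := 2)) ?nnegrE ?rnorm_ge0 ?addr_ge0// rnorm_sqr sqrrD.
rewrite !real_normK ?num_real// lerD2r lerDl.
by rewrite mulrn_wge0// mulr_ge0.
Qed.

(** A positive element of R[i] has imaginary part 0, so the epsilon of the normed module may be
    taken in R. *)
Lemma cvg_rnormP (V : normedModType R[i]) (u : V^nat) (l : V) :
  u @ \oo --> l <-> forall e : R, 0 < e -> \forall n \near \oo, rnorm (u n - l) < e.
Proof.
split=> [/cvgrPdist_lt ul e e0|ul].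
  have e0' : (0 : R[i]) < e%:C by rewrite (ltcR 0 e).
  near=> n; rewrite -ltcR -rnormE distrC.
  by near: n; exact: ul.
apply/cvgrPdist_lt => -[e b] e0.
have : (0 : R[i]) < e +i* b by [].
rewrite ltcE /= => /andP[/eqP -> {}e0].
near=> n; rewrite rnormE ltcR rnormB.
by near: n; exact: ul.
Unshelve. all: by end_near. Qed.

Lemma continuous_rnormP (f : R[i]^o -> R[i]^o) (z : R[i]) :
  {for z, continuous f} ->
  forall e : R, 0 < e ->
    exists2 d : R, 0 < d & forall w, rnorm (w - z) < d -> rnorm (f w - f z) < e.
Proof.
move=> /cvgrPdist_lt cf e e0.
have e0' : (0 : R[i]) < e%:C by rewrite (ltcR 0 e).
have /nbhs_ballP[[d b]] := cf _ e0'.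
rewrite /= ltcE /= => /andP[/eqP -> d0] dP.
exists d => // w wz; rewrite -ltcR -rnormE distrC; apply: dP.
by rewrite /ball /= distrC rnormE ltcR.
Qed.

Lemma rnorm_cvg (V : normedModType R[i]) (u : V^nat) (l : V) :
  u @ \oo --> l -> (fun n => rnorm (u n)) @ \oo --> rnorm l.
Proof.
move=> /cvg_rnormP ul; apply/cvgrPdist_lt => e e0; near=> n.
rewrite distrC; apply: le_lt_trans (ler_dist_rnorm _ _) _.
by near: n; exact: ul.
Unshelve. all: by end_near. Qed.

Lemma cvg_sqrr (u : R^nat) (l : R) :
  u @ \oo --> l -> (fun n => u n ^+ 2) @ \oo --> l ^+ 2.
Proof.
move=> ul; have -> : (fun n => u n ^+ 2) = u \* u by apply/funext => n; rewrite /= expr2.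
by rewrite expr2; exact: cvgM.
Qed.

End rnorm_theory.

(** * Algebra of a resolution of the identity and its spectral measures *)

Section resolution_theory.
Variables (R : realType) (H : completeNormedModType R[i]).
Variables (dot : {dot H for Num.conj}).
Hypothesis dot_norm : forall x : H, dot x x = `|x| ^+ 2.
Variables (E : set R -> H -> H).
Hypothesis hE : resolution_of_identity dot E.

Lemma resD B x y : measurable B -> E B (x + y) = E B x + E B y.
Proof.
case: hE => + _ _ _ => /(_ B) /[apply] -[/(_ 1 x y) + _ _].
by rewrite !scale1r.
Qed.

Lemma resZ B a x : measurable B -> E B (a *: x) = a *: E B x.
Proof.
move=> mB; case: hE => /(_ B mB)[lE _ _] _ _ _.
have := lE 1 0 0; rewrite !scale1r addr0 => /esym/eqP.
rewrite -subr_eq0 addrK => /eqP E0.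
by have := lE a x 0; rewrite E0 !addr0.
Qed.

Lemma resB B x y : measurable B -> E B (x - y) = E B x - E B y.
Proof. by move=> mB; rewrite -scaleN1r resD// resZ// scaleN1r. Qed.

Lemma res_setT x : E setT x = x. Proof. by case: hE. Qed.

Lemma res_set0 x : E set0 x = 0. Proof. by case: hE. Qed.

Lemma res_idem B x : measurable B -> E B (E B x) = E B x.
Proof. by move=> mB; case: hE => /(_ B mB)[]. Qed.

Lemma res_adj B x y : measurable B -> dot (E B x) y = dot x (E B y).
Proof. by move=> mB; case: hE => /(_ B mB)[]. Qed.

(** The pair is padded with [set0] to a sequence, whose partial sums are constant from index 2
    on. *)
Lemma resU A B x : measurable A -> measurable B -> A `&` B = set0 ->
  E (A `|` B) x = E A x + E B x.
Proof.
move=> mA mB AB; case: hE => _ _ _ /(_ (bigcup2 A B)).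
have mF j : measurable (bigcup2 A B j) by case: j => [|[|j]] //=; exact: measurable0.
have tF : trivIset setT (bigcup2 A B) by move: AB; rewrite trivIset_bigcup2.
move=> /(_ mF tF x); rewrite bigcup2E.
move=> cv.
apply: (cvg_unique (@norm_hausdorff _ H) cv); apply: cvg_near_cst; near=> n.
have n2 : (1 < n)%N by near: n; exact: nbhs_infty_gt.
rewrite -(subnK n2) addn2 !big_ord_recl /= /bump /= big1 ?addr0 ?res_set0//.
Unshelve. all: by end_near. Qed.

(** With P = E A and Q = E B, idempotence of P + Q gives PQ + QP = 0. Composing with P on the left
    and on the right yields PQ = - PQP = QP, hence 2 PQ = 0. *)
Lemma res_disj A B x : measurable A -> measurable B -> A `&` B = set0 ->
  E A (E B x) = 0.
Proof.
move=> mA mB AB.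
have mAB : measurable (A `|` B) by exact: measurableU.
have anti z : E A (E B z) + E B (E A z) = 0.
  have := res_idem z mAB; rewrite !resU// !resD// !res_idem//.
  rewrite [E B (E A z) + _]addrC addrACA.
  by rewrite -[RHS]addr0 => /addrI.
have h1 : E A (E B x) + E A (E B (E A x)) = 0.
  by rewrite -[X in X + _](res_idem _ mA) -resD// anti -(scale0r 0) resZ// !scale0r.
have h2 : E A (E B (E A x)) + E B (E A x) = 0.
  by rewrite -{2}(res_idem x mA) anti.
have e1 : E A (E B x) = E B (E A x).
  by rewrite -(addr0_eq h2) -(addr0_eq h1) opprK.
have := anti x; rewrite -e1 -mulr2n -scaler_nat => /eqP.
by rewrite scaler_eq0 pnatr_eq0 /= => /eqP.
Qed.

(** Both sets split along their intersection; by [res_disj] only the product of the common parts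
    survives. *)
Lemma resI A B x : measurable A -> measurable B -> E A (E B x) = E (A `&` B) x.
Proof.
move=> mA mB.
have mI : measurable (A `&` B) by exact: measurableI.
have mA' : measurable (A `\` B) by exact: measurableD.
have mB' : measurable (B `\` A) by exact: measurableD.
have eB : E B x = E (A `&` B) x + E (B `\` A) x.
  rewrite -resU//; first by rewrite setIC setUIDK.
  by rewrite setIC [_ `&` B]setIC setIA; apply/seteqP; split => // t [[[]]].
have eA y : E A y = E (A `&` B) y + E (A `\` B) y.
  rewrite -resU//; first by rewrite setUIDK.
  by apply/seteqP; split => // t [[_ ?]] [_].
rewrite eB resD// [E A (E (B `\` A) x)]res_disj//; last first.
  by apply/seteqP; split => // t [? []].
rewrite addr0 eA res_idem// res_disj ?addr0//.
by apply/seteqP; split => // t [[_ ?]] [_].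
Qed.

(* The two proof arguments make the measure structure inferable. *)
Definition spec_measure (dn : forall x : H, dot x x = `|x| ^+ 2)
  (h : resolution_of_identity dot E) (x : H) (B : set (measurableTypeR R)) : \bar R :=
  (rnorm (E B x) ^+ 2)%:E.

Lemma dot_rnorm x : dot x x = (rnorm x ^+ 2)%:C.
Proof. by rewrite dot_norm rnormE rmorphXn. Qed.

Lemma dot_res A B x : measurable A -> measurable B ->
  dot (E A x) (E B x) = (rnorm (E (A `&` B) x) ^+ 2)%:C.
Proof.
move=> mA mB; rewrite -dot_rnorm.
have mI := measurableI _ _ mA mB.
rewrite res_adj// resI// -(res_idem x mI) -res_adj// res_idem//.
Qed.

Lemma rnorm_sqr_resU A B x : measurable A -> measurable B -> A `&` B = set0 ->
  rnorm (E (A `|` B) x) ^+ 2 = rnorm (E A x) ^+ 2 + rnorm (E B x) ^+ 2.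
Proof.
move=> mA mB AB; apply: complexI.
have d0 : dot (E A x) (E B x) = 0 by rewrite dot_res// AB res_set0 rnorm0 expr0n.
have d0' : dot (E B x) (E A x) = 0 by rewrite dot_res// setIC AB res_set0 rnorm0 expr0n.
rewrite rmorphD /= -!dot_rnorm resU// !(linearDl, linearDr) /=.
by rewrite d0 d0' !addr0 add0r.
Qed.

Section measure_instance.
Variable x : H.
Local Notation nu := (spec_measure dot_norm hE x).

Let nu0 : nu set0 = 0%E.
Proof. by rewrite /spec_measure res_set0 rnorm0 expr0n. Qed.

Let nu_ge0 B : (0 <= nu B)%E.
Proof. by rewrite lee_fin sqr_ge0. Qed.

Lemma rnorm_res_bigsetU (F : (set R)^nat) n :
  (forall j, measurable (F j)) -> trivIset setT F ->
  E (\big[setU/set0]_(j < n) F j) x = \sum_(j < n) E (F j) x /\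
  rnorm (E (\big[setU/set0]_(j < n) F j) x) ^+ 2 =
    \sum_(j < n) rnorm (E (F j) x) ^+ 2.
Proof.
move=> mF tF; elim: n => [|n [IH1 IH2]].
  by rewrite !big_ord0 res_set0 rnorm0 expr0n.
have mU : measurable (\big[setU/set0]_(j < n) F j) by exact: bigsetU_measurable.
have d : \big[setU/set0]_(j < n) F j `&` F n = set0.
  by apply: (@trivIset_bigsetUI _ predT) => //; exact: sub_trivIset tF.
by rewrite !big_ord_recr /= rnorm_sqr_resU// IH2 resU// IH1.
Qed.

(** Strong convergence of the vector sums passes to their squared norms, which are the partial sums
    of the measures by Pythagoras. *)
Let nu_sigma : semi_sigma_additive nu.
Proof.
move=> F mF tF mU; have [_ _ _ /(_ F mF tF x) cv] := hE.
have -> : (fun n => \sum_(0 <= i < n) nu (F i))%E =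
    (fun n => ((rnorm (\sum_(j < n) E (F j) x)) ^+ 2)%:E).
  apply/funext => n; rewrite sumEFin big_mkord.
  by have [<- ->] := rnorm_res_bigsetU n mF tF.
have h := rnorm_cvg cv.
apply: cvg_EFin; first exact: nearW.
exact: cvg_sqrr.
Qed.

HB.instance Definition _ := isMeasure.Build _ _ _
  (spec_measure dot_norm hE x) nu0 nu_ge0 nu_sigma.

Let nu_fin : fin_num_fun nu. Proof. by []. Qed.

HB.instance Definition _ := Measure_isFinite.Build _ _ _
  (spec_measure dot_norm hE x) nu_fin.

End measure_instance.

End resolution_theory.

(** * The isometry for simple functions *)

Lemma ReD (R : realType) (x y : R[i]) : Re (x + y) = Re x + Re y.
Proof. by case: x y => [a b] [c d]. Qed.

Lemma Re_sum (R : realType) (I : Type) (r : seq I) (F : I -> R[i]) :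
  Re (\sum_(i <- r) F i) = \sum_(i <- r) Re (F i).
Proof. exact: (big_morph _ (@ReD R) erefl). Qed.

Lemma ReMr (R : realType) (z : R[i]) (r : R) : Re (z * r%:C) = Re z * r.
Proof. by case: z => [a b] /=; rewrite mulr0 subr0. Qed.

Section simple_isometry.
Variables (R : realType) (H : completeNormedModType R[i]).
Variables (dot : {dot H for Num.conj}).
Hypothesis dot_norm : forall x : H, dot x x = `|x| ^+ 2.
Variables (E : set R -> H -> H).
Hypothesis hE : resolution_of_identity dot E.
Local Notation nu := (spec_measure dot_norm hE).

(* The sets A i need not be disjoint: both squared norms below expand into the
   same combination of the measures of A i `&` A j, so that no common refinement
   of two simple functions is ever needed. *)
Lemma rnorm_sqr_sum_indic (I : Type) (r : seq I) (a : I -> R[i]) (A : I -> set R) t :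
  rnorm (\sum_(i <- r) a i * (\1_(A i) t)%:C) ^+ 2 =
  \sum_(i <- r) \sum_(j <- r) Re (a i * Num.conj (a j)) * \1_(A i `&` A j) t.
Proof.
rewrite rnorm_sqrE rmorph_sum /= mulr_suml Re_sum; apply: eq_bigr => i _.
rewrite mulr_sumr Re_sum; apply: eq_bigr => j _.
rewrite rmorphM /= -[RHS]ReMr indicI rmorphM /= [Num.conj _%:C]conj_Creal; last first.
  by apply/complex_realP; eexists.
by congr Re; ring.
Qed.

Lemma rnorm_sqr_sum_res (I : Type) (r : seq I) (a : I -> R[i]) (A : I -> set R) x :
  (forall i, measurable (A i)) ->
  rnorm (\sum_(i <- r) a i *: E (A i) x) ^+ 2 =
  \sum_(i <- r) \sum_(j <- r)
    Re (a i * Num.conj (a j)) * rnorm (E (A i `&` A j) x) ^+ 2.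
Proof.
move=> mA; have -> : forall y : H, rnorm y ^+ 2 = Re (dot y y).
  by move=> y; rewrite (dot_rnorm dot_norm).
rewrite linear_sumlz /= Re_sum; apply: eq_bigr => i _.
rewrite linear_sumr /= Re_sum; apply: eq_bigr => j _.
by rewrite linearZl_LR linearZr /= (dot_res dot_norm hE)// mulrA ReMr.
Qed.

Lemma simple_isometry (I : Type) (r : seq I) (a : I -> R[i]) (A : I -> set R) x :
  (forall i, measurable (A i)) ->
  (rnorm (\sum_(i <- r) a i *: E (A i) x) ^+ 2)%:E =
  (\int[nu x]_t (rnorm (\sum_(i <- r) a i * (\1_(A i) t)%:C) ^+ 2)%:E)%E.
Proof.
move=> mA; rewrite rnorm_sqr_sum_res//.
under eq_integral do rewrite rnorm_sqr_sum_indic -sumEFin.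
have mAA i j : measurable (A i `&` A j) by exact: measurableI.
have iAA i j : (nu x).-integrable setT
    (fun t => (Re (a i * Num.conj (a j)) * \1_(A i `&` A j) t)%:E).
  under eq_fun do rewrite EFinM.
  apply: integrableZl => //. exact: (integrable_indic (nu x) (mAA i j)).
rewrite integral_sum//; last first.
  move=> i; under eq_fun do rewrite -sumEFin.
  exact: integrable_sum.
rewrite -sumEFin; apply: eq_bigr => i _.
under eq_integral do rewrite -sumEFin.
rewrite integral_sum// -sumEFin; apply: eq_bigr => j _.
under eq_integral do rewrite EFinM.
rewrite integralZl//; last exact: (integrable_indic (nu x) (mAA i j)).
by rewrite integral_indic ?setIT //; exact: mAA.
Qed.

Lemma measurable_rnorm_sqr_sum_indic (I : Type) (r : seq I) (a : I -> R[i])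
    (A : I -> set R) : (forall i, measurable (A i)) ->
  measurable_fun [set: measurableTypeR R]
    (fun t => rnorm (\sum_(i <- r) a i * (\1_(A i) t)%:C) ^+ 2).
Proof.
move=> mA; under eq_fun do rewrite rnorm_sqr_sum_indic.
apply: measurable_sum => i; apply: measurable_sum => j.
apply: measurable_funM => //; apply: measurable_realfun.measurable_indic.
exact: (measurableI _ _ (mA i) (mA j)).
Qed.

End simple_isometry.

Section simple_functions.
Variable R : realType.
Implicit Types (s f : R -> R[i]) (D : set R).

Lemma simple_sum_indic s D t : simple_fun s ->
  \sum_(c <- fset_set (range s)) c * (\1_(D `&` s @^-1` [set c]) t)%:C =
  s t * (\1_D t)%:C.
Proof.
have iE c : \1_(D `&` s @^-1` [set c]) t = \1_D t * (s t == c)%:R :> R.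
  rewrite !indicE in_setI -mulnb natrM; congr (_ * _%:R).
  by congr nat_of_bool; apply/idP/eqP; rewrite inE.
case=> fs _; rewrite (bigD1_seq (s t)) ?fset_uniq//=; last first.
  by rewrite in_fset_set// inE; exists t.
rewrite big1 ?addr0 => [|c]; first by rewrite iE eqxx mulr1.
by rewrite eq_sym iE => /negPf ->; rewrite mulr0 mulr0.
Qed.

Lemma simple_fun_bounded s : simple_fun s ->
  exists M : R, forall t, rnorm (s t) <= M.
Proof.
case=> fs _; exists (\sum_(c <- fset_set (range s)) rnorm c) => t.
rewrite (bigD1_seq (s t)) ?fset_uniq//=; last first.
  by rewrite in_fset_set// inE; exists t.
by rewrite lerDl sumr_ge0// => c _; exact: rnorm_ge0.
Qed.

Lemma rnormM_indic (z : R[i]) D t : rnorm (z * (\1_D t)%:C) = rnorm z * \1_D t.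
Proof. by rewrite rnormM rnorm_real ger0_norm. Qed.

End simple_functions.

(** * The isometry for spectral integrals *)

Section spectral_isometry.
Variables (R : realType) (H : completeNormedModType R[i]).
Variables (dot : {dot H for Num.conj}).
Hypothesis dot_norm : forall x : H, dot x x = `|x| ^+ 2.
Variables (E : set R -> H -> H).
Hypothesis hE : resolution_of_identity dot E.
Local Notation nu := (spec_measure dot_norm hE).

(** The difference is a single combination indexed by the sum type [I + J], with signs reversed on
    J. *)
Lemma simple_isometry2 (I J : Type) (r : seq I) (q : seq J)
    (a : I -> R[i]) (A : I -> set R) (b : J -> R[i]) (B : J -> set R) x :
  (forall i, measurable (A i)) -> (forall j, measurable (B j)) ->
  (rnorm (\sum_(i <- r) a i *: E (A i) x - \sum_(j <- q) b j *: E (B j) x) ^+ 2)%:E =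
  (\int[nu x]_t (rnorm (\sum_(i <- r) a i * (\1_(A i) t)%:C -
                        \sum_(j <- q) b j * (\1_(B j) t)%:C) ^+ 2)%:E)%E /\
  measurable_fun [set: measurableTypeR R]
    (fun t => rnorm (\sum_(i <- r) a i * (\1_(A i) t)%:C -
                     \sum_(j <- q) b j * (\1_(B j) t)%:C) ^+ 2).
Proof.
move=> mA mB.
pose rq := map inl r ++ map inr q.
pose ab (k : I + J) := match k with inl i => a i | inr j => - b j end.
pose AB (k : I + J) := match k with inl i => A i | inr j => B j end.
have mAB k : measurable (AB k) by case: k.
have e1 : \sum_(i <- r) a i *: E (A i) x - \sum_(j <- q) b j *: E (B j) x =
    \sum_(k <- rq) ab k *: E (AB k) x.
  rewrite big_cat !big_map /= -sumrN; congr (_ + _).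
  by apply: eq_bigr => j _; rewrite scaleNr.
have e2 t : \sum_(i <- r) a i * (\1_(A i) t)%:C - \sum_(j <- q) b j * (\1_(B j) t)%:C =
    \sum_(k <- rq) ab k * (\1_(AB k) t)%:C.
  rewrite big_cat !big_map /= -sumrN; congr (_ + _).
  by apply: eq_bigr => j _; rewrite mulNr.
split.
  rewrite e1 (simple_isometry dot_norm hE)//.
  by apply: eq_integral => t _; rewrite e2.
by under eq_fun do rewrite e2; exact: measurable_rnorm_sqr_sum_indic.
Qed.

Lemma simple_spectral_integralE D s x : simple_fun s ->
  simple_spectral_integral E D s x =
  \sum_(c <- fset_set (range s)) c *: E (D `&` s @^-1` [set c]) x.
Proof. by case=> fs _; rewrite /simple_spectral_integral fsbig_finite. Qed.

Lemma simple_spectral_integral_isometry (a : R[i]) B D s x :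
  measurable B -> measurable D -> simple_fun s ->
  (rnorm (a *: E B x - simple_spectral_integral E D s x) ^+ 2)%:E =
  (\int[nu x]_t (rnorm (a * (\1_B t)%:C - s t * (\1_D t)%:C) ^+ 2)%:E)%E /\
  measurable_fun [set: measurableTypeR R]
    (fun t => rnorm (a * (\1_B t)%:C - s t * (\1_D t)%:C) ^+ 2).
Proof.
move=> mB mD ss; have [_ ms] := ss.
have mDs c : measurable (D `&` s @^-1` [set c]) by exact: measurableI.
have [] := @simple_isometry2 unit R[i] [:: tt] (fset_set (range s)) (fun=> a)
  (fun=> B) id (fun c => D `&` s @^-1` [set c]) x (fun=> mB) mDs.
rewrite big_seq1 simple_spectral_integralE// => -> mf; split.
  by apply: eq_integral => t _; rewrite big_seq1 simple_sum_indic.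
move: mf; apply: eq_measurable_fun => t _.
by rewrite big_seq1 simple_sum_indic.
Qed.

Lemma simple_spectral_integralB_isometry D s1 s2 x :
  measurable D -> simple_fun s1 -> simple_fun s2 ->
  (rnorm (simple_spectral_integral E D s1 x - simple_spectral_integral E D s2 x) ^+ 2)%:E =
  (\int[nu x]_t (rnorm ((s1 t - s2 t) * (\1_D t)%:C) ^+ 2)%:E)%E /\
  measurable_fun [set: measurableTypeR R]
    (fun t => rnorm ((s1 t - s2 t) * (\1_D t)%:C) ^+ 2).
Proof.
move=> mD ss1 ss2; have [_ ms1] := ss1; have [_ ms2] := ss2.
have mDs1 c : measurable (D `&` s1 @^-1` [set c]) by exact: measurableI.
have mDs2 c : measurable (D `&` s2 @^-1` [set c]) by exact: measurableI.
have [] := @simple_isometry2 _ _ (fset_set (range s1)) (fset_set (range s2)) id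
  (fun c => D `&` s1 @^-1` [set c]) id (fun c => D `&` s2 @^-1` [set c]) x mDs1 mDs2.
rewrite !simple_spectral_integralE// => -> mf; split.
  by apply: eq_integral => t _; rewrite !simple_sum_indic// mulrBl.
move: mf; apply: eq_measurable_fun => t _.
by rewrite !simple_sum_indic// mulrBl.
Qed.

(** Dominated convergence along the approximating simple functions. Since f is known only through
    them, measurability of the limit integrand is part of the conclusion. *)
Lemma spectral_isometry (a : R[i]) B D f x y :
  measurable B -> measurable D -> is_spectral_integral E D f x y ->
  (rnorm (a *: E B x - y) ^+ 2)%:E =
  (\int[nu x]_t (rnorm (a * (\1_B t)%:C - f t * (\1_D t)%:C) ^+ 2)%:E)%E /\
  measurable_fun [set: measurableTypeR R]
    (fun t => rnorm (a * (\1_B t)%:C - f t * (\1_D t)%:C) ^+ 2).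
Proof.
move=> mB mD [s [ss sf sy]].
pose g n t := rnorm (a * (\1_B t)%:C - s n t * (\1_D t)%:C) ^+ 2.
pose g' t := rnorm (a * (\1_B t)%:C - f t * (\1_D t)%:C) ^+ 2.
have gE n : (rnorm (a *: E B x - simple_spectral_integral E D (s n) x) ^+ 2)%:E =
    (\int[nu x]_t (g n t)%:E)%E.
  by have [] := simple_spectral_integral_isometry a x mB mD (ss n).
have mg n : measurable_fun [set: measurableTypeR R] (g n).
  by have [] := simple_spectral_integral_isometry a x mB mD (ss n).
have sD e t : 0 < e -> \forall n \near \oo,
    rnorm (s n t * (\1_D t)%:C - f t * (\1_D t)%:C) < e.
  move=> e0; near=> n; rewrite -mulrBl rnormM_indic indicE.
  have [tD|tD] := boolP (t \in D); last by rewrite mulr0.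
  rewrite mulr1; move: tD; rewrite inE; move: t; near: n; exact: sf.
have gcvg t : g ^~ t @ \oo --> g' t.
  have h : rnorm (a * (\1_B t)%:C - s n t * (\1_D t)%:C) @[n --> \oo] -->
      rnorm (a * (\1_B t)%:C - f t * (\1_D t)%:C).
    apply/cvgrPdist_lt => e e0; near=> n.
    apply: le_lt_trans (ler_dist_rnorm _ _) _.
    rewrite opprB addrC subrKA; near: n; exact: sD.
  exact: cvg_sqrr.
have mg' : measurable_fun [set: measurableTypeR R] g'.
  by apply: measurable_fun_cvg => [n|t _]; [exact: mg|exact: gcvg].
split => //.
(* The sequence is shifted by N so that on D all its terms are within 1 of f, hence within 2 of the
   function [s N], which is bounded by M. This gives the constant majorant, integrable because the
   spectral measure is finite. *)
have [N _ NP] := sf 1 ltr01.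
have [M MP] := simple_fun_bounded (ss N).
pose K := rnorm a + (M + 2).
have gK n t : (`|(g (n + N)%N t)%:E| <= (K ^+ 2)%:E)%E.
  rewrite gee0_abs ?lee_fin ?sqr_ge0// ler_pXn2r ?nnegrE ?rnorm_ge0//; last first.
    by rewrite addr_ge0 ?rnorm_ge0// addr_ge0// (le_trans _ (MP 0)) ?rnorm_ge0.
  apply: le_trans (rnormD _ _) _; rewrite rnormN !rnormM_indic; apply: lerD.
    by rewrite ler_piMr ?rnorm_ge0// indicE lern1 leq_b1.
  rewrite indicE; have [|tD] := boolP (t \in D); last first.
    by rewrite mulr0 addr_ge0// (le_trans _ (MP 0)) ?rnorm_ge0.
  rewrite inE mulr1 => tD.
  have := NP _ (leq_addl n N) t tD; have := NP N (leqnn N) t tD.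
  have := MP t; have := rnormBD (f t) (s (n + N)%N t) 0.
  have := rnormBD (s N t) (f t) 0; rewrite !subr0 (rnormB (f t) (s N t)); lra.
have [_ _ /= lim1] : [/\ (nu x).-integrable setT (EFin \o g'),
    [sequence \int[nu x]_t `|(g (n + N)%N t)%:E - (EFin \o g') t|]_n @ \oo --> 0 &
    [sequence \int[nu x]_t (g (n + N)%N t)%:E]_n @ \oo --> \int[nu x]_t (g' t)%:E]%E.
  apply: (@dominated_convergence _ _ _ _ _ _ _ _ (EFin \o cst (K ^+ 2))) => //.
  - by move=> n; exact/measurable_EFinP.
  - exact/measurable_EFinP.
  - apply: aeW => t _; apply: cvg_EFin; first exact: nearW.
    by rewrite (cvg_shiftn N (g ^~ t)); exact: gcvg.
  - exact: finite_measure_integrable_cst.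
  - by apply: aeW => t n _; exact: gK.
have lim2 : (rnorm (a *: E B x - simple_spectral_integral E D (s (n + N)%N) x) ^+ 2)%:E
    @[n --> \oo] --> (rnorm (a *: E B x - y) ^+ 2)%:E.
  apply: cvg_EFin; first exact: nearW.
  apply: cvg_sqrr; apply: rnorm_cvg; apply: cvgB; first exact: cvg_cst.
  by rewrite (cvg_shiftn N (fun n => simple_spectral_integral E D (s n) x)).
apply: (cvg_unique _ lim2) => //.
suff -> : (fun n => (rnorm (a *: E B x -
    simple_spectral_integral E D (s (n + N)%N) x) ^+ 2)%:E) =
  (fun n => \int[nu x]_t (g (n + N)%N t)%:E)%E by [].
by apply/funext => n; exact: gE.
Unshelve. all: by end_near. Qed.


End spectral_isometry.

(** * Existence of spectral integrals *)

Section floor_approximation.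
Variable R : realType.

Definition floor_approx (n : nat) (u : R) : R :=
  (Num.floor (u * n.+1%:R))%:~R / n.+1%:R.

Lemma floor_approx_dist n u : `|floor_approx n u - u| <= n.+1%:R^-1.
Proof.
have n0 : 0 < n.+1%:R :> R by [].
have /andP[h1 h2] := floor_itv (u * n.+1%:R).
rewrite /floor_approx -{2}(mulfK (lt0r_neq0 n0) u) -mulrBl normrM.
rewrite [X in _ * X]gtr0_norm ?invr_gt0// ler_piMl ?invr_ge0// ler_norml.
by move: h2; rewrite intrD => h2; apply/andP; split; lra.
Qed.

Lemma finite_floor_approx n (M : R) :
  finite_set [set floor_approx n u | u in [set u | `|u| <= M]].
Proof.
have [K KM] : exists K : nat, M * n.+1%:R <= K%:R.
  exists (Num.bound (`|M * n.+1%:R|)).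
  by rewrite ltW// (le_lt_trans (ler_norm _))// archi_boundP.
apply: (@sub_finite_set _ _
  [set ((k%:R - K%:R) / n.+1%:R : R) | k in `I_(K + K).+1]); last first.
  exact: finite_image.
move=> _ [u /= uM <-].
have n0 : 0 < n.+1%:R :> R by [].
have uK : `|u * n.+1%:R| <= K%:R.
  by rewrite normrM (gtr0_norm n0) (le_trans _ KM)// ler_pM2r.
move: uK; rewrite ler_norml => /andP[h1 h2].
have f1 : (- K%:Z <= Num.floor (u * n.+1%:R))%R.
  by rewrite floor_ge_int rmorphN.
have f2 : (Num.floor (u * n.+1%:R) <= K%:Z)%R.
  by rewrite -(intrKfloor (R := R) K%:Z) le_floor.
rewrite /floor_approx; set m := Num.floor _ in f1 f2 *.
have [k kE] : exists k : nat, m = k%:Z - K%:Z.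
  by exists (absz (m + K%:Z)); rewrite gez0_abs; lia.
by exists k => /=; [lia|rewrite kE intrD rmorphN].
Qed.


End floor_approximation.

Lemma measurable_floor_approx (R : realType) n :
  measurable_fun [set: R] (@floor_approx R n).
Proof.
apply: nondecreasing_measurable => // u v uv.
by rewrite /floor_approx ler_pM2r ?invr_gt0// ler_int le_floor// ler_pM2r.
Qed.

Lemma cauchy_rnorm_cvg (R : realType) (H : completeNormedModType R[i]) (u : H^nat) :
  (forall e : R, 0 < e -> exists N, \forall n \near \oo, rnorm (u n - u N) < e) ->
  cvg (u @ \oo).
Proof.
move=> h; apply: cauchy_cvg; apply: cauchy_exP => -[e b].
rewrite ltcE /= => /andP[/eqP -> e0].
have [N hN] := h e e0; exists (u N); near=> n.
rewrite -ball_normE /ball_ /= distrC rnormE ltcR; near: n; exact: hN.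
Unshelve. all: by end_near. Qed.

Section spectral_integral_existence.
Variables (R : realType) (H : completeNormedModType R[i]).
Variables (dot : {dot H for Num.conj}).
Hypothesis dot_norm : forall x : H, dot x x = `|x| ^+ 2.
Variables (E : set R -> H -> H).
Hypothesis hE : resolution_of_identity dot E.
Local Notation nu := (spec_measure dot_norm hE).

(** The isometry applies, and the spectral measure of x has total mass |x|^2. *)
Lemma simple_spectral_integralB_le D s1 s2 x (c : R) :
  measurable D -> simple_fun s1 -> simple_fun s2 -> 0 <= c ->
  (forall t, D t -> rnorm (s1 t - s2 t) <= c) ->
  rnorm (simple_spectral_integral E D s1 x - simple_spectral_integral E D s2 x) <=
  c * rnorm x.
Proof.
move=> mD ss1 ss2 c0 sc.
rewrite -(ler_pXn2r (n := 2)) ?nnegrE ?mulr_ge0 ?rnorm_ge0// -lee_fin.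
have [-> mg] := simple_spectral_integralB_isometry dot_norm hE x mD ss1 ss2.
rewrite exprMn EFinM -{2}(res_setT hE x).
rewrite -[X in (_ * X)%E]/(nu x setT) -integral_cst//.
apply: ge0_le_integral => //.
- by move=> t _; rewrite ?lee_fin /= ?lee_fin sqr_ge0.
- exact/measurable_EFinP.
move=> t _; rewrite lee_fin ler_pXn2r ?nnegrE ?rnorm_ge0//.
rewrite rnormM_indic indicE; have [|_] := boolP (t \in D); last by rewrite mulr0.
by rewrite inE mulr1; exact: sc.
Qed.

(** Real and imaginary part, extended by 0 outside D, are rounded down to the grid of mesh 1 / (n +
    1). Boundedness leaves finitely many values, monotone rounding keeps level sets measurable, and
    the error is uniform. *)
Lemma simple_approximation D (f : R -> R[i]) (M : R) :
  measurable D -> measurable_fun D (fun t => Re (f t)) ->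
  measurable_fun D (fun t => Im (f t)) ->
  (forall t, D t -> rnorm (f t) <= M) ->
  exists s : nat -> R -> R[i], (forall n, simple_fun (s n)) /\
   (forall e : R, 0 < e ->
     \forall n \near \oo, forall t, D t -> rnorm (s n t - f t) < e).
Proof.
move=> mD mRe mIm fM.
pose u := (fun t => Re (f t)) \_ D.
pose v := (fun t => Im (f t)) \_ D.
have mu : measurable_fun setT u by exact/(measurable_restrictT _ mD).
have mv : measurable_fun setT v by exact/(measurable_restrictT _ mD).
have uM t : `|u t| <= `|M|.
  rewrite /u patchE; case: ifPn => [|_]; last by rewrite normr0.
  rewrite inE => /fM h; rewrite (le_trans (ler_Re_rnorm _))//.
  by rewrite (le_trans h)// ler_norm.
have vM t : `|v t| <= `|M|.
  rewrite /v patchE; case: ifPn => [|_]; last by rewrite normr0.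
  rewrite inE => /fM h; rewrite (le_trans (ler_Im_rnorm _))//.
  by rewrite (le_trans h)// ler_norm.
exists (fun n t => floor_approx n (u t) +i* floor_approx n (v t)); split.
  move=> n; split.
    apply: (@sub_finite_set _ _ [set a +i* b |
      a in [set floor_approx n u | u in [set u | `|u| <= `|M|]] &
      b in [set floor_approx n u | u in [set u | `|u| <= `|M|]]]).
      move=> _ [t _ <-]; exists (floor_approx n (u t)).
        by exists (u t) => //=; exact: uM.
      exists (floor_approx n (v t)) => //.
      by exists (v t) => //=; exact: vM.
    by apply: finite_image2; exact: finite_floor_approx.
  case=> a b.
  have -> : (fun t => floor_approx n (u t) +i* floor_approx n (v t)) @^-1`
      [set a +i* b] = ((@floor_approx R n \o u) @^-1` [set a]) `&`
                      ((@floor_approx R n \o v) @^-1` [set b]).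
    by apply/seteqP; split => t /= [-> ->].
  apply: measurableI.
    rewrite -[X in measurable X]setTI; apply: measurableT_comp => //.
    exact: measurable_floor_approx.
  rewrite -[X in measurable X]setTI; apply: measurableT_comp => //.
  exact: measurable_floor_approx.
move=> e e0.
have e2 : 0 < e / 2 by rewrite divr_gt0.
have := near_infty_natSinv_lt (PosNum e2) => /= hn.
near=> n => t Dt.
have ne : n.+1%:R^-1 < e / 2 by near: n; exact: hn.
have tD : t \in D by rewrite inE.
have uE : u t = Re (f t) by rewrite /u patchE tD.
have vE : v t = Im (f t) by rewrite /v patchE tD.
apply: le_lt_trans (ler_rnorm_ReIm _) _.
have := floor_approx_dist n (u t); have := floor_approx_dist n (v t).
rewrite uE vE; case: (f t) => a b.
rewrite -[_ - (a +i* b)]/((_ - a) +i* (_ - b)) /=.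
by move=> /le_lt_trans-/(_ _ ne) hb /le_lt_trans-/(_ _ ne) ha; lra.
Unshelve. all: by end_near. Qed.

(** The integrals of the simple approximants form a Cauchy sequence, so the choice in
    [spectral_integral] does not fall back to its default value 0. *)
Lemma spectral_integralP D (f : R -> R[i]) (M : R) x :
  measurable D -> measurable_fun D (fun t => Re (f t)) ->
  measurable_fun D (fun t => Im (f t)) ->
  (forall t, D t -> rnorm (f t) <= M) ->
  is_spectral_integral E D f x (spectral_integral E D f x).
Proof.
move=> mD mRe mIm fM.
have [s [ss sf]] := simple_approximation mD mRe mIm fM.
suff /cvg_ex[y sy] : cvg (simple_spectral_integral E D (s n) x @[n --> \oo]).
  by apply: (@xgetI _ 0 [set y | is_spectral_integral E D f x y] y); exists s.
apply: cauchy_rnorm_cvg => e e0.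
(* Two approximants within c of f differ by at most 2 c, their integrals by at most 2 c |x| < e; the
   summand 1 allows x = 0. *)
pose c := e / (rnorm x + 1) / 2.
have x0 := rnorm_ge0 x.
have c0 : 0 < c by rewrite !divr_gt0// ltr_wpDl.
have [N _ NP] := sf c c0.
exists N; near=> n.
have Nn : (N <= n)%N by near: n; exact: nbhs_infty_ge.
apply: (@le_lt_trans _ _ (c * 2 * rnorm x)).
  apply: simple_spectral_integralB_le => //; first by rewrite mulr_ge0// ltW.
  move=> t Dt; have := NP _ Nn t Dt; have := NP _ (leqnn N) t Dt.
  by have := rnormBD (f t) (s n t) (s N t); rewrite (rnormB (f t)); lra.
rewrite /c divfK// mulrAC ltr_pdivrMr; last by rewrite ltr_wpDl.
by rewrite ltr_pM2l// ltrDl.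
Unshelve. all: by end_near. Qed.

End spectral_integral_existence.

(** * Continuity of the integrands, bounds for periodic functions *)

Section continuity.
Variable R : realType.
Implicit Types (f : R -> R[i]).

(** Continuity into R[i] with a real epsilon, so that all estimates take place in R. *)
Definition rnorm_continuous_at f (t : R) :=
  forall e : R, 0 < e -> \forall u \near t, rnorm (f u - f t) < e.

Lemma ReB (x y : R[i]) : Re (x - y) = Re x - Re y.
Proof. by case: x y => [a b] [c d]. Qed.

Lemma ImB (x y : R[i]) : Im (x - y) = Im x - Im y.
Proof. by case: x y => [a b] [c d]. Qed.

Lemma rnorm_continuous_measurable f (D : set R) : open D ->
  (forall t, D t -> rnorm_continuous_at f t) ->
  measurable_fun D (fun t => Re (f t)) /\ measurable_fun D (fun t => Im (f t)).
Proof.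
move=> oD cf; split; apply: open_continuous_measurable_fun => // t.
  rewrite inE => /cf {}cf; apply/cvgrPdist_lt => e e0; near=> u.
  rewrite -ReB; apply: le_lt_trans (ler_Re_rnorm _) _.
  by rewrite rnormB; near: u; exact: cf.
rewrite inE => /cf {}cf; apply/cvgrPdist_lt => e e0; near=> u.
rewrite -ImB; apply: le_lt_trans (ler_Im_rnorm _) _.
by rewrite rnormB; near: u; exact: cf.
Unshelve. all: by end_near. Qed.

Lemma rnorm_cexp (t : R) : rnorm (cexp t) = 1.
Proof.
apply/eqP; rewrite -(@eqrXn2 _ 2) ?rnorm_ge0// rnorm_sqr /= cos2Dsin2.
by rewrite expr1n.
Qed.

Lemma cexp_continuous (a t : R) : rnorm_continuous_at (fun s => cexp (s * a)) t.
Proof.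
move=> e e0; have e2 : 0 < e / 2 by rewrite divr_gt0.
have cc : {for t, continuous (fun s : R => cos (s * a) : R)}.
  apply: (@continuous_comp R R R ( *%R^~ a)); last exact: continuous_cos.
  exact: mulrr_continuous.
have cs : {for t, continuous (fun s : R => sin (s * a) : R)}.
  apply: (@continuous_comp R R R ( *%R^~ a)); last exact: continuous_sin.
  exact: mulrr_continuous.
move/cvgrPdist_lt : cc => /(_ _ e2) cc.
move/cvgrPdist_lt : cs => /(_ _ e2) cs.
near=> u; apply: le_lt_trans (ler_rnorm_ReIm _) _.
rewrite ReB ImB /= distrC [X in _ + X]distrC.
rewrite [ltRHS]splitr ltrD//; near: u; [exact: cc|exact: cs].
Unshelve. all: by end_near. Qed.

Lemma comp_rnorm_continuous (phi : R[i] -> R[i]) f t :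
  continuous (phi : R[i]^o -> R[i]^o) -> rnorm_continuous_at f t ->
  rnorm_continuous_at (phi \o f) t.
Proof.
move=> cphi cf e e0.
have [d d0 dP] := continuous_rnormP (cphi (f t)) e0.
by have := cf _ d0; apply: filterS => u; exact: dP.
Qed.

Lemma within_rnorm_continuous (D : set R) f t : open D ->
  {within D, continuous (f : R -> R[i]^o)} -> D t -> rnorm_continuous_at f t.
Proof.
move=> oD; rewrite continuous_open_subspace// => cf Dt e e0.
have /cvgrPdist_lt := cf t (mem_set Dt).
have e0' : (0 : R[i]) < e%:C by rewrite (ltcR 0 e).
move=> /(_ _ e0'); apply: filterS => u.
by rewrite rnormE ltcR rnormB.
Qed.

Lemma periodic_bounded (psi : R -> R) (T : R) : 0 < T ->
  continuous psi -> periodic psi T -> exists M : R, forall t, psi t <= M.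
Proof.
move=> T0 cpsi ppsi.
have [c _ cP] := @EVT_max R psi 0 T (ltW T0) (continuous_subspaceT cpsi).
exists (psi c) => t.
(* Truncation yields a natural number, so t is first moved to the nonnegative half-line and then
   reduced to [0, T]. *)
have [n tn] : exists n : nat, 0 <= t + T *+ n.
  exists (Num.bound (`|t| / T)).
  have := archi_boundP (divr_ge0 (normr_ge0 t) (ltW T0)).
  rewrite ltr_pdivrMr// mulr_natl; have := ler_norm (- t); rewrite normrN; lra.
rewrite -(periodicn ppsi n t); set u := t + _ in tn *.
pose m := Num.trunc (u / T).
have /andP[m1 m2] := truncn_itv (divr_ge0 tn (ltW T0)).
rewrite ler_pdivlMr// in m1; rewrite ltr_pdivrMr// in m2.
have -> : psi u = psi (u - T *+ m) by rewrite -[in RHS](periodicn ppsi m) subrK.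
apply: cP; rewrite in_itv /= subr_ge0 -mulr_natl m1 /=.
by move: m2; rewrite -natr1 mulrDl mul1r => m2; lra.
Qed.

End continuity.

(** * Operators of the theorem in terms of the spectral measure *)

Section spectral_formulas.
Variables (R : realType) (H : completeNormedModType R[i]).
Variables (dot : {dot H for Num.conj}).
Hypothesis dot_norm : forall x : H, dot x x = `|x| ^+ 2.
Variables (E : set R -> H -> H).
Hypothesis hE : resolution_of_identity dot E.
Local Notation nu := (spec_measure dot_norm hE).

Lemma spectral_integral_isometry (a : R[i]) B D (f : R -> R[i]) (M : R) x :
  measurable B -> open D -> (forall t, D t -> rnorm_continuous_at f t) ->
  (forall t, D t -> rnorm (f t) <= M) ->
  (rnorm (a *: E B x - spectral_integral E D f x) ^+ 2)%:E =
  (\int[nu x]_t (rnorm (a * (\1_B t)%:C - f t * (\1_D t)%:C) ^+ 2)%:E)%E /\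
  measurable_fun [set: measurableTypeR R]
    (fun t => rnorm (a * (\1_B t)%:C - f t * (\1_D t)%:C) ^+ 2).
Proof.
move=> mB oD cf fM; have mD : measurable D by exact: open_measurable.
have [mRe mIm] := rnorm_continuous_measurable oD cf.
apply: spectral_isometry => //.
exact: (spectral_integralP dot_norm hE _ mD mRe mIm fM).
Qed.

(** With a = 1 and B = D the integrand of the isometry vanishes identically. *)
Lemma spectral_integral1 D x : open D -> spectral_integral E D (fun=> 1) x = E D x.
Proof.
move=> oD; have mD : measurable D by exact: open_measurable.
have [] := @spectral_integral_isometry 1 D D (fun=> 1) 1 x mD oD.
- by move=> t _ e e0; near=> u; rewrite subrr rnorm0.
- by move=> t _; rewrite rnorm1.
under eq_integral do rewrite subrr rnorm0 expr0n.
rewrite integral0 scale1r => -[] /eqP + _.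
by rewrite sqrf_eq0 rnorm_eq0 subr_eq0 => /eqP.
Unshelve. all: by end_near. Qed.

Lemma rnorm_sub_unitary x t :
  (rnorm (x - unitary_group E t x) ^+ 2)%:E =
  (\int[nu x]_s (rnorm (1 - cexp (s * t)) ^+ 2)%:E)%E /\
  measurable_fun [set: measurableTypeR R] (fun s => rnorm (1 - cexp (s * t)) ^+ 2).
Proof.
have [] := @spectral_integral_isometry 1 setT setT (fun s => cexp (s * t)) 1 x
  measurableT openT (fun s _ => @cexp_continuous R t s).
  by move=> s _; rewrite rnorm_cexp.
rewrite (res_setT hE) scale1r => -> mf; split.
  by apply: eq_integral => s _; rewrite !indicT !mulr1.
by move: mf; apply: eq_measurable_fun => s _; rewrite !indicT !mulr1.
Qed.

Lemma rnorm_gen_diff (phi : R[i] -> R[i]) x t :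
  continuous (phi : R[i]^o -> R[i]^o) -> class_Phi (psi_of phi) ->
  (rnorm (gen_diff E phi t x) ^+ 2)%:E =
  (\int[nu x]_s (psi_of phi (t * s))%:E)%E.
Proof.
move=> cphi [cpsi _ ppsi _ _].
have [M MP] := periodic_bounded (mulrn_wgt0 2 (pi_gt0 R)) cpsi ppsi.
have cf s : setT s -> rnorm_continuous_at (fun s => phi (cexp (t * s))) s.
  move=> _; apply: (@comp_rnorm_continuous _ phi (fun s => cexp (t * s))) => //.
  under eq_fun do rewrite mulrC; exact: cexp_continuous.
have fM s : setT s -> rnorm (phi (cexp (t * s))) <= Num.sqrt M.
  move=> _; rewrite -(ger0_norm (rnorm_ge0 _)) -sqrtr_sqr ler_sqrt.
    exact: (MP (t * s)).
  by rewrite (le_trans _ (MP 0))// sqr_ge0.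
have [] := @spectral_integral_isometry 0 setT setT _ _ x measurableT openT cf fM.
rewrite scale0r sub0r rnormN => -> _.
by apply: eq_integral => s _; rewrite mul0r sub0r rnormN indicT mulr1.
Qed.

Lemma rnorm_sub_multiplier sigma (lambda : R -> R[i]) x :
  multiplier sigma lambda ->
  (rnorm (x - multiplier_op E sigma lambda x) ^+ 2)%:E =
  (\int[nu x]_t
     (rnorm (1 - lambda t * (\1_`]- sigma, sigma[ t)%:C) ^+ 2)%:E)%E /\
  measurable_fun [set: measurableTypeR R]
    (fun t => rnorm (1 - lambda t * (\1_`]- sigma, sigma[ t)%:C) ^+ 2).
Proof.
case=> cl [M MP] _; have oD : open `]- sigma, sigma[%classic by exact: interval_open.
have lM t : `]- sigma, sigma[%classic t -> rnorm (lambda t) <= M.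
  by rewrite /= in_itv /= -ltr_norml; exact: MP.
have [] := @spectral_integral_isometry 1 setT _ lambda M x measurableT oD
  (fun t => within_rnorm_continuous oD cl) lM.
rewrite (res_setT hE) scale1r => -> mf; split.
  by apply: eq_integral => s _; rewrite indicT !mul1r.
by move: mf; apply: eq_measurable_fun => s _; rewrite indicT !mul1r.
Qed.

(** With D the open interval, x - E_D g = (x - E_D x) + E_D (x - g) has orthogonal summands, so the
    infimum is attained at E_D x. *)
Lemma best_approxE sigma x :
  best_approx E sigma x = rnorm (x - E `]- sigma, sigma[%classic x).
Proof.
have oD : open `]- sigma, sigma[%classic by exact: interval_open.
set D := `]- sigma, sigma[%classic in oD *.
have mD : measurable D by exact: open_measurable.
have WE h : W_space E sigma h <-> exists g, h = E D g.
  split=> [[g _ <-]|[g ->]]; first by exists g; rewrite spectral_integral1.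
  by exists g => //; rewrite spectral_integral1.
have pyth g : rnorm (x - E D g) ^+ 2 =
    rnorm (x - E D x) ^+ 2 + rnorm (E D (x - g)) ^+ 2.
  have -> : x - E D g = (x - E D x) + E D (x - g).
    by rewrite (resB hE)// addrA subrK.
  have d0 : dot (x - E D x) (E D (x - g)) = 0.
    by rewrite -(res_adj hE)// (resB hE)// (res_idem hE)// subrr linear0l.
  have d0' : dot (E D (x - g)) (x - E D x) = 0.
    by rewrite (res_adj hE)// (resB hE)// (res_idem hE)// subrr linear0r.
  move: d0 d0'; move: (x - E D x) (E D (x - g)) => u v d0 d0'.
  apply: complexI; rewrite rmorphD /= -!(dot_rnorm dot_norm) linearDl.
  by rewrite !linearDr /= d0 d0' addr0 add0r.
apply/eqP; rewrite eq_le; apply/andP; split.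
  apply: ge_inf; first by exists 0 => _ [h _ <-]; exact: rnorm_ge0.
  by exists (E D x) => //; apply/WE; exists x.
apply: lb_le_inf.
  by exists (rnorm (x - E D x)), (E D x) => //; apply/WE; exists x.
move=> _ [h /WE[g ->] <-].
by rewrite -(ler_pXn2r (n := 2)) ?nnegrE ?rnorm_ge0// [leRHS]pyth lerDl sqr_ge0.
Qed.

End spectral_formulas.

(** * Scaling of Lebesgue measure *)

Section scaling.
Variable R : realType.
Local Notation mu := (@lebesgue_measure R).
Local Notation MR := (measurableTypeR R).

Lemma measurable_divr (d : R) : measurable_fun [set: MR] (fun t : MR => t / d : MR).
Proof. by apply: continuous_measurable_fun; exact: mulrr_continuous. Qed.

(** The pushforward under t -> t / d, multiplied by 1 / d, has the right value on half-open
    intervals, and these determine Lebesgue measure. *)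
Lemma lebesgue_measure_divr (d : R) (A : set R) : 0 < d -> measurable A ->
  pushforward mu (fun t => t / d : MR) A = (d%:E * mu A)%E.
Proof.
move=> d0 mA.
pose phi := fun t : MR => t / d : MR.
have mphi : measurable_fun setT phi := measurable_divr d.
pose di : {nonneg R} := NngNum (ltW (divr_gt0 ltr01 d0)).
pose mu' : {measure set MR -> \bar R} := mscale di (pushforward mu phi).
have : mu A = mu' mphi A.
  apply: (@lebesgue_measure_unique R (mu' mphi)) => // _ [[a b]] _ <-.
  have -> : mu' mphi `]a, b]%classic = (d^-1%:E * mu (phi @^-1` `]a, b]))%E.
    by rewrite /mu' /= /mscale /pushforward /= mul1r.
  have -> : phi @^-1` `]a, b] = `]a * d, b * d]%classic.
    apply/seteqP; split => t /=; rewrite !in_itv /= /phi.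
      by rewrite ltr_pdivlMr// ler_pdivrMr.
    by rewrite ltr_pdivlMr// ler_pdivrMr.
  rewrite !lebesgue_measure_itv/= !lte_fin ltr_pM2r//.
  case: ifPn => _; last by rewrite mule0.
  by rewrite -!EFinD -EFinM -mulrBl mulrCA mulVf ?mulr1// lt0r_neq0.
move=> ->; have -> : mu' mphi A = (d^-1%:E * pushforward mu phi A)%E.
  by rewrite /mu' /= /mscale /= mul1r.
by rewrite muleA -EFinM divff ?mul1e// lt0r_neq0.
Qed.

Lemma ge0_integral_divr (d : R) (g : R -> \bar R) : 0 < d ->
  measurable_fun [set: MR] g -> (forall t, 0 <= g t)%E ->
  (\int[mu]_t g (t / d)%R = d%:E * \int[mu]_u g u)%E.
Proof.
move=> d0 mg g0.
pose dn : {nonneg R} := NngNum (ltW d0).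
have -> : (d%:E * \int[mu]_u g u = \int[mscale dn mu]_u g u)%E.
  by rewrite ge0_integral_mscale.
pose phi := fun t : MR => t / d : MR.
have mphi : measurable_fun setT phi := measurable_divr d.
have := @ge0_integral_pushforward _ _ _ _ R phi mphi mu setT g measurableT mg.
rewrite preimage_setT => <- //.
apply: eq_measure_integral => A mA _.
exact: (lebesgue_measure_divr d0 mA).
Qed.

Lemma open_negligible_set0 (A : set R) : open A -> mu.-negligible A -> A = set0.
Proof.
move=> oA nA; have [//|/set0P[x Ax]] := eqVneq A set0.
have /nbhs_ballP[e /= e0 eA] := open_nbhs_nbhs (conj oA Ax).
have [B [mB B0 AB]] := nA.
have : (mu (ball x e) <= mu B)%E.
  apply: le_measure; rewrite ?inE//; first exact: measurable_ball.
  exact: subset_trans eA AB.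
rewrite B0 lebesgue_measure_ball; last exact: ltW.
by rewrite lee_fin leNgt mulrn_wgt0.
Qed.

End scaling.

(** * The function Gamma: boundedness, continuity, positivity off 0 *)

Section Gamma_theory.
Variable R : realType.
Variables (psi V : R -> R).
Hypothesis hpsi : class_Phi psi.
Hypothesis hV : weight V.
Local Notation mu := (@lebesgue_measure R).
Local Notation MR := (measurableTypeR R).
Local Notation Gam := (Gamma psi V).

Lemma class_Phi_bounded : exists M : R, forall t, `|psi t| <= M.
Proof.
case: hpsi => cpsi psi0 ppsi _ _.
have [M MP] := periodic_bounded (mulrn_wgt0 2 (pi_gt0 R)) cpsi ppsi.
by exists M => t; rewrite ger0_norm.
Qed.

Lemma measurable_psiM t : measurable_fun [set: MR] (fun s : MR => psi (t * s) : R).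
Proof.
case: hpsi => cpsi _ _ _ _; apply: continuous_measurable_fun => s.
by apply: (@continuous_comp R R R ( *%R t)); [exact: mulrl_continuous|exact: cpsi].
Qed.

Let mI : measurable (`[0, 1]%classic : set MR). Proof. exact: measurable_itv. Qed.

Lemma Gamma_integrable t :
  mu.-integrable `[0, 1]%classic (EFin \o (fun s => psi (t * s) * V s)).
Proof.
have [_ iV _ _] := hV; have [M MP] := class_Phi_bounded.
apply: (@integrableMr _ _ _ mu _ _ (fun s => psi (t * s)) (EFin \o V)) => //.
  by apply: measurable_funTS; exact: measurable_psiM.
exists M; split; first exact: num_real.
by move=> x Mx s _ /=; rewrite (le_trans (MP _))// ltW.
Qed.

Lemma Gamma_EFin t :
  (Gam t)%:E = (\int[mu]_(s in `[0%R, 1%R]) (psi (t * s)%R * V s)%:E)%E.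
Proof.
by rewrite /Gamma /Rintegral fineK//; apply: integrable_fin_num => //; exact: Gamma_integrable.
Qed.

Lemma Gamma_ge0 t : 0 <= Gam t.
Proof.
have [V0 _ _ _] := hV; have [_ psi0 _ _ _] := hpsi.
by apply: Rintegral_ge0 => s s01; rewrite mulr_ge0// V0.
Qed.

Lemma Gamma_at0 : Gam 0 = 0.
Proof.
have [_ _ _ _ p0] := hpsi; rewrite /Gamma.
under eq_Rintegral do rewrite mul0r p0 mul0r.
by rewrite /Rintegral integral0.
Qed.

Lemma Gamma_bounded : exists M : R, forall t, Gam t <= M.
Proof.
have [V0 iV _ V1] := hV; have [M MP] := class_Phi_bounded.
exists M => t; rewrite -[leRHS]mulr1 -V1 -RintegralZl//.
apply: le_Rintegral => //; first exact: Gamma_integrable.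
  exact: (integrableZl mI M iV).
by move=> s s01; rewrite ler_wpM2r ?V0// (le_trans (ler_norm _)).
Qed.

Lemma Gamma_continuous : continuous Gam.
Proof.
move=> t; have [V0 iV _ _] := hV; have [M MP] := class_Phi_bounded.
have [cpsi _ _ _ _] := hpsi.
apply: (@continuity_under_integral R _ MR mu (fun t s => psi (t * s) * V s)
  `[0, 1]%classic mI (t - 1) (t + 1) _ _ (fun s => M * V s)).
- by move=> u _; exact: Gamma_integrable.
- apply: aeW => s _ u _; apply: cvgM; last exact: cvg_cst.
  by apply: (@continuous_comp R R R ( *%R^~ s)); [exact: mulrr_continuous|exact: cpsi].
- exact: (integrableZl mI M iV).
- move=> u _; apply: aeW => s s01; rewrite normrM [X in _ * X]ger0_norm ?V0//.
  by rewrite ler_wpM2r ?V0.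
- by rewrite inE /= in_itv /= ltrBlDr ltrDl ltr01.
Qed.

(** If the integral were 0, then psi (t * s) would vanish for almost every s, because V is nonzero
    almost everywhere. The open set of s in ]0, 1[ where it does not vanish is then negligible,
    hence empty, and psi is 0 on an interval, against its nowhere dense zero set. *)
Lemma Gamma_gt0 t : t != 0 -> 0 < Gam t.
Proof.
move=> t0; rewrite lt_neqAle Gamma_ge0 andbT; apply/eqP => /esym G0.
have [V0 iV Vne _] := hV; have [cpsi psi0 _ nd _] := hpsi.
have : (\int[mu]_(s in `[0%R, 1%R]) `|(psi (t * s)%R * V s)%:E| = (Gam t)%:E)%E.
  rewrite Gamma_EFin; apply: eq_integral => s.
  by rewrite inE /= => s01; rewrite ger0_norm// mulr_ge0 ?V0.
rewrite G0 => /(ae_eq_integral_abs mu mI (measurable_int _ (Gamma_integrable t))).1 aeG.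
pose O := `]0, 1[%classic `&` [set s : R | psi (t * s) != 0].
have oO : open O.
  apply: openI; first exact: interval_open.
  apply: (@open_comp _ _ (fun s : R => psi (t * s)) [set x | x != 0]).
    move=> s _; apply: (@continuous_comp R R R ( *%R t)); last exact: cpsi.
    exact: mulrl_continuous.
  exact: open_neq.
have nO : mu.-negligible O.
  apply: negligibleS (negligibleU aeG Vne) => s [/= s01 ps].
  have s01' : s \in `[0, 1] by apply: subset_itv_oo_cc.
  apply/not_andP => -[/(_ s01') h /(_ s01') Vs].
  by move: h => /= [] /eqP; rewrite mulf_eq0 (negPf ps) (negPf Vs).
have O0 := open_negligible_set0 oO nO.
have z s : 0 < s < 1 -> psi (t * s) = 0.
  move=> s01; apply/eqP; apply/negPn/negP => ps.
  suff : O s by rewrite O0.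
  by split => //=; rewrite in_itv.
(* The ball of centre t / 2 and radius |t| / 2 is the open interval between 0 and t. *)
have : interior (closure [set u | psi u = 0]) (t / 2).
  have t2 : 0 < `|t| / 2 by rewrite divr_gt0 ?normr_gt0.
  apply/nbhs_ballP; exists (`|t| / 2) => //= u /= tu.
  apply: subset_closure => /=.
  have -> : u = t * (u / t) by rewrite mulrCA divff ?mulr1.
  apply: z; move: tu; rewrite /ball /=.
  have -> : t / 2 - u = t * (2^-1 - u / t) by rewrite mulrBr [t * (u / t)]mulrCA divff ?mulr1.
  rewrite normrM ltr_pM2l ?normr_gt0// ltr_norml => /andP[h1 h2].
  by apply/andP; split; lra.
by rewrite nd.
Qed.

End Gamma_theory.

(** * The generalized modulus as an integral of Gamma *)

Section gen_modulus_formula.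
Variables (R : realType) (H : completeNormedModType R[i]).
Variables (dot : {dot H for Num.conj}).
Hypothesis dot_norm : forall x : H, dot x x = `|x| ^+ 2.
Variables (E : set R -> H -> H).
Hypothesis hE : resolution_of_identity dot E.
Variables (phi : R[i] -> R[i]) (phi_cont : continuous (phi : R[i]^o -> R[i]^o)).
Hypothesis hpsi : class_Phi (psi_of phi).
Variables (delta : R) (V : R -> R).
Hypothesis delta_gt0 : 0 < delta.
Hypothesis hV : weight V.
Local Notation nu := (spec_measure dot_norm hE).
Local Notation mu := (@lebesgue_measure R).
Local Notation MR := (measurableTypeR R).
Local Notation psi := (psi_of phi).

(** V is controlled on [0, 1] only; its extension by 0 is nonnegative and measurable on the line, so
    Tonelli can be applied on the whole product. *)
Let W := V \_ `[0, 1]%classic.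

Let mW : measurable_fun [set: MR] W.
Proof.
have [_ iV _ _] := hV.
apply/(measurable_restrictT _ (measurable_itv `[0, 1])).
by apply/measurable_EFinP; exact: measurable_int iV.
Qed.

Let W_ge0 t : 0 <= W t.
Proof.
have [V0 _ _ _] := hV; rewrite /W patchE; case: ifPn => //.
by rewrite inE; exact: V0.
Qed.

Let psi_ge0 t : 0 <= psi t. Proof. exact: sqr_ge0. Qed.

Let F (z : MR * MR) : \bar R := (psi (z.1 * z.2) * W (z.1 / delta))%:E.

Let mF : measurable_fun setT F.
Proof.
have [cpsi _ _ _ _] := hpsi.
apply/measurable_EFinP; apply: measurable_funM.
  apply: (measurableT_comp (continuous_measurable_fun cpsi)).
  apply: measurable_funM; [exact: measurable_fst|exact: measurable_snd].
apply: (measurableT_comp mW); apply: (measurableT_comp (measurable_divr delta)).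
exact: measurable_fst.
Qed.

Let F_ge0 z : (0 <= F z)%E.
Proof. by rewrite lee_fin mulr_ge0. Qed.

(** The substitution t = delta u turns psi(t s) into psi(delta s u). *)
Let inner_t s : (\int[mu]_t F (t, s) = delta%:E * (Gamma psi V (delta * s))%:E)%E.
Proof.
rewrite Gamma_EFin//.
have mG : measurable_fun [set: MR] (fun u : MR => (psi (delta * s * u) * W u)%:E).
  apply/measurable_EFinP; apply: measurable_funM => //.
  exact: measurable_psiM.
transitivity (delta%:E * \int[mu]_u (psi (delta * s * u) * W u)%:E)%E; last first.
  congr (_ * _)%E; rewrite [in RHS]integral_mkcond; apply: eq_integral => u _; rewrite /W !patchE.
  by case: ifPn => // _; rewrite mulr0.
rewrite -ge0_integral_divr//; last by move=> t; rewrite lee_fin mulr_ge0.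
apply: eq_integral => t _; rewrite /F /=; congr (psi _ * _)%:E.
by field; rewrite lt0r_neq0.
Qed.

Let inner_s x t :
  (\int[nu x]_s F (t, s) = (rnorm (gen_diff E phi t x) ^+ 2 * W (t / delta))%:E)%E.
Proof.
rewrite EFinM (rnorm_gen_diff dot_norm hE)// -ge0_integralZr//; last first.
- by rewrite lee_fin.
- by move=> s _; rewrite lee_fin.
- by apply/measurable_EFinP; exact: measurable_psiM.
Qed.

Lemma measurable_Gamma : measurable_fun [set: MR] (fun s => Gamma psi V (delta * s)).
Proof.
apply: continuous_measurable_fun => s.
apply: (@continuous_comp R R R ( *%R delta)); first exact: mulrl_continuous.
exact: Gamma_continuous.
Qed.

Lemma gen_modulus_sqr x :
  (gen_modulus E phi V delta x ^+ 2)%:E =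
  (\int[nu x]_s (Gamma psi V (delta * s))%:E)%E.
Proof.
have [V0 _ _ _] := hV.
have e : (\int[mu]_(t in `[0%R, delta])
    (rnorm (gen_diff E phi t x) ^+ 2 * V (t / delta))%:E =
    delta%:E * \int[nu x]_s (Gamma psi V (delta * s))%:E)%E.
  rewrite integral_mkcond.
  transitivity (\int[mu]_t \int[nu x]_s F (t, s))%E.
    apply: eq_integral => t _; rewrite inner_s /W !patchE.
    have -> : (t \in `[0, delta]%classic) = (t / delta \in `[0, 1]%classic).
      rewrite !mem_setE !in_itv /= ler_pdivrMr// mul1r.
      by rewrite pmulr_lge0 ?invr_gt0.
    by case: ifPn => // _; rewrite mulr0.
  rewrite (fubini_tonelli F)//.
  under eq_integral do rewrite inner_t.
  rewrite ge0_integralZl//.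
  - by apply/measurable_EFinP; exact: measurable_Gamma.
  - by move=> s _; rewrite lee_fin Gamma_ge0.
  - by rewrite lee_fin ltW.
have [M MP] := Gamma_bounded hpsi hV.
(* [gen_modulus] uses a real-valued integral, which would collapse an infinite value; boundedness of
   Gamma and finiteness of the spectral measure exclude this. *)
have fin : (\int[nu x]_s (Gamma psi V (delta * s))%:E)%E \is a fin_num.
  apply: integrable_fin_num => //.
  apply: measurable_bounded_integrable => //.
  - by rewrite ltry.
  - exact: measurable_Gamma.
  - exists M; split; first exact: num_real.
    by move=> y My s _ /=; rewrite ger0_norm ?Gamma_ge0// (le_trans (MP _))// ltW.
rewrite /gen_modulus /Rintegral e -(fineK fin) -EFinM /= mulKf ?lt0r_neq0//.
rewrite sqr_sqrtr// fine_ge0//; apply: integral_ge0 => s _.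
by rewrite lee_fin Gamma_ge0.
Qed.

End gen_modulus_formula.

Lemma ediv_EFin (R : realType) (p q : R) : q != 0 -> (p%:E / q%:E = (p / q)%:E)%E.
Proof. by move=> q0; rewrite inver (negPf q0) EFinM. Qed.

(** * The constants of (A) and (B), including infinite values *)

Section constants.
Variable R : realType.
Variables (psi V : R -> R) (delta sigma : R) (lambda : R -> R[i]).
Hypothesis hpsi : class_Phi psi.
Hypothesis hV : weight V.
Hypothesis delta_gt0 : 0 < delta.
Hypothesis sigma_gt0 : 0 < sigma.
Hypothesis lambda0 : lambda 0 = 1.
Local Notation Gam := (Gamma psi V).

Let Gam_gt0 t : t != 0 -> 0 < Gam (delta * t).
Proof. by move=> t0; rewrite Gamma_gt0// mulf_neq0// lt0r_neq0. Qed.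

Lemma calG_le t : sigma <= `|t| -> calG psi V delta sigma <= Gam (delta * t).
Proof.
move=> st; apply: ge_inf; last by exists t.
by exists 0 => _ [u _ <-]; exact: Gamma_ge0.
Qed.

Lemma le_calG m : (forall t, sigma <= `|t| -> m <= Gam (delta * t)) ->
  m <= calG psi V delta sigma.
Proof.
move=> mG; apply: lb_le_inf; last by move=> _ [t st <-]; exact: mG.
by exists (Gam (delta * sigma)), sigma => //=; rewrite ger0_norm// ltW.
Qed.

Lemma calG_ge0 : 0 <= calG psi V delta sigma.
Proof. by apply: le_calG => t _; exact: Gamma_ge0. Qed.

Lemma calH_eq0 : calH psi V delta sigma = 0.
Proof.
apply/eqP; rewrite eq_le; apply/andP; split.
  apply: ge_inf; first by exists 0 => _ [u _ <-]; exact: Gamma_ge0.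
  by exists 0; rewrite /= ?normr0 ?ltW// mulr0 Gamma_at0.
apply: lb_le_inf; last by move=> _ [u _ <-]; exact: Gamma_ge0.
by exists (Gam (delta * 0)), 0 => //=; rewrite normr0 ltW.
Qed.

Lemma constB_ge0 : (0 <= constB psi V delta sigma)%E.
Proof.
rewrite /constB mul1e inver; case: ifPn => // _.
by rewrite lee_fin invr_ge0 calG_ge0.
Qed.

Lemma constB_mul t : sigma <= `|t| ->
  (1 <= constB psi V delta sigma * (Gam (delta * t))%:E)%E.
Proof.
move=> st; have t0 : t != 0 by rewrite -normr_gt0 (lt_le_trans sigma_gt0).
rewrite /constB mul1e inver; case: ifPn => [_|G0].
  (* If the infimum is 0, the constant is +oo, but Gamma at the individual point is still
     positive. *)
  by rewrite gt0_mulye ?leey// lte_fin Gam_gt0.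
have Gp : 0 < calG psi V delta sigma by rewrite lt_neqAle eq_sym G0 calG_ge0.
by rewrite -EFinM lee_fin ler_pdivlMl// mulr1 calG_le.
Qed.

(** The hypothesis bounds Gamma below by 1 / c, so the infimum is positive and the quotient finite;
    taken at t = sigma it excludes c = 0. *)
Lemma constB_le c : 0 <= c ->
  (forall t, sigma <= `|t| -> 1 <= c * Gam (delta * t)) ->
  (constB psi V delta sigma <= c%:E)%E.
Proof.
move=> c0 h.
have cp : 0 < c.
  rewrite lt_neqAle c0 andbT; apply/eqP => ce.
  have := h sigma; rewrite ger0_norm; last exact: ltW.
  by rewrite lexx -ce mul0r ler10 => /(_ isT).
have cG : c^-1 <= calG psi V delta sigma.
  by apply: le_calG => t /h ?; rewrite -[leLHS]mulr1 ler_pdivrMl.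
have Gp : 0 < calG psi V delta sigma by rewrite (lt_le_trans _ cG)// invr_gt0.
by rewrite /constB ediv_EFin ?lt0r_neq0// div1r lee_fin -[leRHS]invrK lef_pV2 ?posrE ?invr_gt0.
Qed.

(** Terms with lambda t = 1 are 0 on both sides; at any other t the term of [constA] is +oo, as
    [calH] is 0. *)
Lemma constA_pointwise_le :
  (constA_pointwise psi V delta sigma lambda <= constA psi V delta sigma lambda)%E.
Proof.
rewrite /constA /constA_pointwise ge_max; apply/andP; split; last first.
  by rewrite le_max lexx orbT.
rewrite le_max; apply/orP; left; apply: ge_ereal_sup => _ [t st <-].
apply: (@le_trans _ _
  ((rnorm (1 - lambda t) ^+ 2)%:E / (calH psi V delta sigma)%:E)%E); last first.
  by apply: ereal_sup_ubound; exists t.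
have [->|n0] := eqVneq (rnorm (1 - lambda t)) 0; first by rewrite expr0n !mul0e.
rewrite calH_eq0 inve0 gt0_muley ?leey// lte_fin exprn_gt0//.
by rewrite lt_neqAle eq_sym n0 rnorm_ge0.
Qed.

Lemma constB_constA_pointwise :
  (constB psi V delta sigma <= constA_pointwise psi V delta sigma lambda)%E.
Proof. by rewrite /constA_pointwise le_max lexx orbT. Qed.

(** At t = 0 both sides vanish, even for an infinite constant; elsewhere Gamma is positive and the
    quotient is genuine. *)
Lemma constA_pointwise_mul t : `|t| < sigma ->
  ((rnorm (1 - lambda t) ^+ 2)%:E <=
   constA_pointwise psi V delta sigma lambda * (Gam (delta * t))%:E)%E.
Proof.
move=> st; have [->|t0] := eqVneq t 0.
  by rewrite lambda0 subrr rnorm0 expr0n mulr0 (Gamma_at0 _ hpsi) mule0.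
have G0 := Gam_gt0 t0.
apply: (@le_trans _ _ ((rnorm (1 - lambda t) ^+ 2)%:E / (Gam (delta * t))%:E *
    (Gam (delta * t))%:E)%E).
  by rewrite ediv_EFin ?lt0r_neq0// -EFinM divfK// lt0r_neq0.
apply: lee_wpmul2r; first by rewrite lee_fin ltW.
rewrite /constA_pointwise le_max; apply/orP; left; apply: ereal_sup_ubound.
by exists t => //=; rewrite in_itv /= -ltr_norml.
Qed.

(** The point t = 0 may be left out of the hypothesis, as its term in the supremum is 0 / 0 = 0. *)
Lemma constA_pointwise_finite_le c : 0 <= c ->
  (forall t, `|t| < sigma -> t != 0 -> rnorm (1 - lambda t) ^+ 2 <= c * Gam (delta * t)) ->
  (constB psi V delta sigma <= c%:E)%E ->
  (constA_pointwise psi V delta sigma lambda <= c%:E)%E.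
Proof.
move=> c0 h hB; rewrite /constA_pointwise ge_max hB andbT.
apply: ge_ereal_sup => _ [t /= ts <-].
have [->|t0] := eqVneq t 0; first by rewrite lambda0 subrr rnorm0 expr0n mul0e lee_fin.
rewrite ediv_EFin ?lt0r_neq0 ?Gam_gt0// lee_fin ler_pdivrMr ?Gam_gt0// h//.
by move: ts; rewrite in_itv /= -ltr_norml.
Qed.

Lemma constA_le c : 0 <= c ->
  (forall t, `|t| < sigma -> rnorm (1 - lambda t) = 0) ->
  (constB psi V delta sigma <= c%:E)%E -> (constA psi V delta sigma lambda <= c%:E)%E.
Proof.
move=> c0 h hB; rewrite /constA ge_max hB andbT.
apply: ge_ereal_sup => _ [t /= ts <-].
by rewrite h ?expr0n ?mul0e ?lee_fin//; move: ts; rewrite in_itv /= -ltr_norml.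
Qed.

End constants.

Lemma ge0_integral_eq0_ae d (T : measurableType d) (R : realType)
    (mu : {measure set T -> \bar R}) (h : T -> R) :
  measurable_fun [set: T] h -> (forall t, 0 <= h t) ->
  (\int[mu]_t (h t)%:E = 0)%E -> {ae mu, forall t, h t = 0}.
Proof.
move=> mh h0 i0.
have /(ae_eq_integral_abs mu measurableT _).1 : (\int[mu]_t `|(h t)%:E| = 0)%E.
  by rewrite -[RHS]i0; apply: eq_integral => t _; rewrite gee0_abs// lee_fin.
move=> /(_ ((measurable_EFinP _ _).2 mh)).
by apply: filterS => t /(_ Logic.I) [].
Qed.

(** * The upper bounds *)

Section inequalities.
Variables (R : realType) (H : completeNormedModType R[i]).
Variables (dot : {dot H for Num.conj}).
Hypothesis dot_norm : forall x : H, dot x x = `|x| ^+ 2.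
Variables (E : set R -> H -> H).
Hypothesis hE : resolution_of_identity dot E.
Variables (phi : R[i] -> R[i]) (phi_cont : continuous (phi : R[i]^o -> R[i]^o)).
Hypothesis hpsi : class_Phi (psi_of phi).
Variables (sigma delta : R) (V : R -> R).
Hypothesis sigma_gt0 : 0 < sigma.
Hypothesis delta_gt0 : 0 < delta.
Hypothesis hV : weight V.
Local Notation nu := (spec_measure dot_norm hE).
Local Notation MR := (measurableTypeR R).
Local Notation psi := (psi_of phi).
Local Notation Gam := (Gamma psi V).

Let Gam_ge0 t : 0 <= Gam t. Proof. exact: Gamma_ge0. Qed.

Let mGam : measurable_fun [set: MR] (fun t : MR => Gam (delta * t)).
Proof. exact: measurable_Gamma. Qed.

Lemma moved_gen_modulus_gt0 x : moved E x -> 0 < gen_modulus E phi V delta x ^+ 2.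
Proof.
move=> [t]; apply: contra_notT; rewrite -leNgt => g0.
have /ge0_integral_eq0_ae : (\int[nu x]_s (Gam (delta * s))%:E = 0)%E.
  rewrite -(gen_modulus_sqr dot_norm hE)//; congr _%:E; apply/eqP.
  by rewrite eq_le g0 sqr_ge0.
move=> /(_ mGam (fun s => Gam_ge0 _)) ae0.
have [e mU] := rnorm_sub_unitary dot_norm hE x t.
have : (\int[nu x]_s (rnorm (1 - cexp (s * t)) ^+ 2)%:E = \int[nu x]_s (cst 0 s))%E.
  apply: ge0_ae_eq_integral => //.
  - exact/measurable_EFinP.
  - by move=> s _; rewrite lee_fin sqr_ge0.
  apply: filterS ae0 => s Gs _.
  have -> : s = 0.
    apply/eqP/negPn/negP => s0.
    have : 0 < Gam (delta * s) by rewrite Gamma_gt0// mulf_neq0// lt0r_neq0.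
    by rewrite Gs ltxx.
  have -> : cexp (0 * t) = 1 :> R[i] by rewrite mul0r /cexp cos0 sin0.
  by rewrite subrr rnorm0 expr0n.
rewrite integral0 -e => -[] /eqP.
by rewrite sqrf_eq0 rnorm_eq0 subr_eq0 => /eqP.
Qed.

(** The constant is an arbitrary extended real, so that the pointwise form of (A) and, with lambda =
    1, also (B) are instances. *)
Lemma multiplier_inequality lambda (C : \bar R) x :
  multiplier sigma lambda -> moved E x ->
  (forall t, `|t| < sigma ->
    ((rnorm (1 - lambda t) ^+ 2)%:E <= C * (Gam (delta * t))%:E)%E) ->
  (constB psi V delta sigma <= C)%E ->
  ((rnorm (x - multiplier_op E sigma lambda x) ^+ 2)%:E <=
   C * (gen_modulus E phi V delta x ^+ 2)%:E)%E.
Proof.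
move=> hl mx hC hB.
have C0 : (0 <= C)%E by apply: le_trans hB; exact: constB_ge0.
have g0 := moved_gen_modulus_gt0 mx.
have [-> mh] := rnorm_sub_multiplier dot_norm hE x hl.
have hle t : ((rnorm (1 - lambda t * (\1_`]- sigma, sigma[ t)%:C) ^+ 2)%:E <=
    C * (Gam (delta * t))%:E)%E.
  have [st|st] := ltP `|t| sigma.
    by rewrite indicE mem_set ?mulr1 ?hC//= in_itv /= -ltr_norml.
  rewrite indicE memNset ?mulr0 ?subr0 ?rnorm1 ?expr1n; last first.
    by rewrite /= in_itv /= -ltr_norml; apply/negP; rewrite -leNgt.
  apply: (@le_trans _ _ (constB psi V delta sigma * (Gam (delta * t))%:E)%E).
    exact: constB_mul.
  by apply: lee_wpmul2r; rewrite ?lee_fin.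
(* For C = +oo the right-hand side is +oo because the modulus of a moved vector is positive; -oo is
   excluded by [C0]. *)
move: C C0 hle {hC hB} => [c| |]//; last first.
  by move=> _ _; rewrite gt0_mulye ?leey// lte_fin.
rewrite lee_fin => c0 hle.
rewrite (gen_modulus_sqr dot_norm hE)//.
have <- : (\int[nu x]_t (c%:E * (Gam (delta * t))%:E) =
    c%:E * \int[nu x]_t (Gam (delta * t))%:E)%E.
  apply: ge0_integralZl => //.
  - exact/measurable_EFinP.
  - by move=> t _; rewrite lee_fin.
apply: ge0_le_integral => //.
- by move=> t _; rewrite lee_fin sqr_ge0.
- exact/measurable_EFinP.
- by apply: measurable_funeM; exact/measurable_EFinP.
Qed.

End inequalities.

(** * Sharpness: test vectors carried by an interval *)

Section sharp_interval.
Variables (R : realType) (H : completeNormedModType R[i]).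
Variables (dot : {dot H for Num.conj}).
Hypothesis dot_norm : forall x : H, dot x x = `|x| ^+ 2.
Variables (E : set R -> H -> H).
Hypothesis hE : resolution_of_identity dot E.
Variables (phi : R[i] -> R[i]) (phi_cont : continuous (phi : R[i]^o -> R[i]^o)).
Hypothesis hpsi : class_Phi (psi_of phi).
Variables (sigma delta : R) (V : R -> R).
Hypothesis delta_gt0 : 0 < delta.
Hypothesis hV : weight V.
Local Notation nu := (spec_measure dot_norm hE).
Local Notation MR := (measurableTypeR R).
Local Notation psi := (psi_of phi).
Local Notation Gam := (Gamma psi V).

Let Gam_ge0 t : 0 <= Gam t. Proof. exact: Gamma_ge0. Qed.

Let mGam : measurable_fun [set: MR] (fun t : MR => Gam (delta * t)).
Proof. exact: measurable_Gamma. Qed.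

Lemma ae_spec_measure_range (D : set R) z : measurable D ->
  {ae nu (E D z), forall s, D s}.
Proof.
move=> mD; exists (~` D); split => //; first exact: measurableC.
rewrite /spec_measure (resI hE) ?setICl ?(res_set0 hE) ?rnorm0 ?expr0n//.
exact: measurableC.
Qed.

Lemma spec_measureT x : nu x setT = (rnorm x ^+ 2)%:E.
Proof. by rewrite /spec_measure (res_setT hE). Qed.

(** The total mass |x|^2 is then 0. This turns a contradiction at almost every point into x = 0. *)
Lemma ae_spec_measureF x : {ae nu x, forall s : R, False} -> x = 0.
Proof.
move=> [A [mA A0 AT]].
have TA : A = setT by apply/seteqP; split => // s _; apply: AT => /=.
move: A0; rewrite TA spec_measureT => -[] /eqP.
by rewrite sqrf_eq0 rnorm_eq0 => /eqP.
Qed.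

(* A vector in the range of E [a, b], 0 outside [a, b], has its spectral measure
   carried by [a, b]; for a suitable t, e^(ist) is then bounded away from 1. *)
Lemma test_vector_moved a b z : 0 < a \/ b < 0 ->
  E `[a, b]%classic z <> 0 -> moved E (E `[a, b]%classic z).
Proof.
move=> ab0 xn0; set x := E _ z in xn0 *.
(* For s in [a, b] the product s * t lies in ]0, 1], where the sine, the imaginary part of e^(ist),
   is positive. *)
pose t := if 0 < a then b^-1 else a^-1.
have st s : s \in `[a, b] -> 0 < s * t < pi.
  rewrite in_itv /= /t => /andP[sa sb].
  have p1 : 1 < pi :> R by rewrite (lt_le_trans _ (pi_ge2 R))// ltr1n.
  case: ifPn => [a0|].
    have s0 : 0 < s by rewrite (lt_le_trans a0).
    have b0 : 0 < b by rewrite (lt_le_trans s0).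
    by rewrite divr_gt0//= (le_lt_trans _ p1)// ler_pdivrMr// mul1r.
  rewrite -leNgt => a0; case: ab0 => [|b0]; first by rewrite ltNge a0.
  have s0 : s < 0 by rewrite (le_lt_trans sb).
  have {}a0 : a < 0 by rewrite (le_lt_trans sa).
  by rewrite nmulr_rgt0// invr_lt0 a0/= (le_lt_trans _ p1)// ler_ndivrMr// mul1r.
exists t => xU; apply: xn0; apply: ae_spec_measureF.
have [e mh] := rnorm_sub_unitary dot_norm hE x t.
move: e; rewrite -xU subrr rnorm0 expr0n => /esym.
move=> /(ge0_integral_eq0_ae mh (fun s => sqr_ge0 _)) ae0.
have mI : measurable (`[a, b]%classic : set R) by exact: measurable_itv.
have aeI := ae_spec_measure_range z mI.
move: ae0 aeI; apply: filterS2 => s /eqP + sI; rewrite sqrf_eq0 rnorm_eq0 subr_eq0.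
move=> /eqP /(congr1 (@complex.Im R)) /= /esym s0.
by have := sin_gt0_pi (st _ sI); rewrite s0 ltxx.
Qed.

(** On x = E [a, b] z the squared error is at least q |x|^2 and the squared modulus at most g |x|^2;
    it remains to divide by |x|^2. The interval avoids 0 so that x is moved. *)
Lemma sharp_interval lambda c a b q g : multiplier sigma lambda ->
  (exists z, E `[a, b]%classic z <> 0) -> 0 < a \/ b < 0 -> 0 <= q ->
  (forall s, s \in `[a, b] ->
    q <= rnorm (1 - lambda s * (\1_`]- sigma, sigma[ s)%:C) ^+ 2) ->
  (forall s, s \in `[a, b] -> Gam (delta * s) <= g) ->
  (forall x, moved E x -> rnorm (x - multiplier_op E sigma lambda x) ^+ 2 <=
     c * gen_modulus E phi V delta x ^+ 2) ->
  0 <= c /\ q <= c * g.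
Proof.
move=> hl [z xn0] ab0 q0 hq hg hc; set x := E _ z in xn0.
have mx : moved E x by exact: test_vector_moved.
have g0 := moved_gen_modulus_gt0 dot_norm hE phi_cont hpsi delta_gt0 hV mx.
have c0 : 0 <= c.
  by rewrite -(pmulr_lge0 _ g0) (le_trans _ (hc _ mx))// sqr_ge0.
split=> //.
have mI : measurable (`[a, b]%classic : set R) by exact: measurable_itv.
have aeI := ae_spec_measure_range z mI.
(* The interval contains a point, since otherwise x would be 0. *)
have g_ge0 : 0 <= g.
  have [s sI] : exists s, `[a, b]%classic s.
    apply: contra_notP xn0 => no; apply: ae_spec_measureF.
    have [N [mN N0 NP]] := aeI; exists N; split => // s _; apply: NP => sI.
    by apply: no; exists s.
  exact: le_trans (Gam_ge0 _) (hg _ sI).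
have x0 : 0 < rnorm x ^+ 2.
  by rewrite exprn_gt0// lt_neqAle eq_sym rnorm_eq0 rnorm_ge0 andbT; apply/eqP.
have [eL mh] := rnorm_sub_multiplier dot_norm hE x hl.
have h1 : q * rnorm x ^+ 2 <= rnorm (x - multiplier_op E sigma lambda x) ^+ 2.
  rewrite -lee_fin eL EFinM -spec_measureT -integral_cst//.
  apply: ae_ge0_le_integral => //.
  - by move=> s _; rewrite lee_fin sqr_ge0.
  - exact/measurable_EFinP.
  - have [N [mN N0 NP]] := aeI; exists N; split => // s /= ns; apply: NP => sI.
    by apply: ns => _; rewrite lee_fin; exact: hq.
have h2 : gen_modulus E phi V delta x ^+ 2 <= g * rnorm x ^+ 2.
  rewrite -lee_fin (gen_modulus_sqr dot_norm hE)// EFinM -spec_measureT -integral_cst//.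
  apply: ae_ge0_le_integral => //.
  - by move=> s _; rewrite lee_fin.
  - exact/measurable_EFinP.
  - have [N [mN N0 NP]] := aeI; exists N; split => // s /= ns; apply: NP => sI.
    by apply: ns => _; rewrite lee_fin; exact: hg.
rewrite -(ler_pM2r x0) (le_trans h1)// (le_trans (hc _ mx))// -mulrA.
by rewrite ler_wpM2l.
Qed.

End sharp_interval.

(** * Sharpness: from intervals to points *)

Section multiplier_error.
Variables (R : realType) (sigma : R) (lambda : R -> R[i]).

(** The integrand of |x - Lambda x|^2 with respect to the spectral measure of x. *)
Definition multiplier_error (s : R) : R :=
  rnorm (1 - lambda s * (\1_`]- sigma, sigma[ s)%:C) ^+ 2.

Lemma multiplier_error_in s : `|s| < sigma ->
  multiplier_error s = rnorm (1 - lambda s) ^+ 2.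
Proof.
by move=> ss; rewrite /multiplier_error indicE mem_set ?mulr1//= in_itv /= -ltr_norml.
Qed.

Lemma multiplier_error_out s : sigma <= `|s| -> multiplier_error s = 1.
Proof.
move=> ss; rewrite /multiplier_error indicE memNset ?mulr0 ?subr0 ?rnorm1 ?expr1n//.
by rewrite /= in_itv /= -ltr_norml; apply/negP; rewrite -leNgt.
Qed.

(* The error function jumps at t = sigma and t = - sigma, hence the one-sided
   neighbourhoods. *)
Lemma multiplier_error_near t e : multiplier sigma lambda -> 0 < e ->
  (exists2 r, 0 < r & forall s, s \in `[t, t + r] ->
     multiplier_error t - e <= multiplier_error s) \/
  (exists2 r, 0 < r & forall s, s \in `[t - r, t] ->
     multiplier_error t - e <= multiplier_error s).
Proof.
move=> [cl _ _] e0; have [st|st] := ltP `|t| sigma; last first.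
  (* Moving away from 0 stays outside the interval, where the error is constantly 1. *)
  have [t0|t0] := leP 0 t.
    left; exists 1 => // s; rewrite in_itv /= => /andP[ts _].
    have ss : sigma <= `|s|.
      by rewrite (le_trans st)// !ger0_norm// (le_trans t0).
    by rewrite (multiplier_error_out st) (multiplier_error_out ss) gerBl ltW.
  right; exists 1 => // s; rewrite in_itv /= => /andP[_ ts].
  have ss : sigma <= `|s|.
    by rewrite (le_trans st)// !ltr0_norm ?lerN2// (le_lt_trans ts).
  by rewrite (multiplier_error_out st) (multiplier_error_out ss) gerBl ltW.
left.
have oD : open `]- sigma, sigma[%classic by exact: interval_open.
have Dt : `]- sigma, sigma[%classic t by rewrite /= in_itv /= -ltr_norml.
have cl' := within_rnorm_continuous oD cl Dt.
have c1 : (fun s => rnorm (1 - lambda s)) @ t --> rnorm (1 - lambda t).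
  apply/cvgrPdist_lt => e' e'0; near=> s.
  apply: le_lt_trans (ler_dist_rnorm _ _) _.
  rewrite opprB addrC subrKA; near: s; exact: cl'.
have c2 : (fun s => rnorm (1 - lambda s) ^+ 2) @ t --> rnorm (1 - lambda t) ^+ 2.
  by rewrite expr2; under eq_fun do rewrite expr2; exact: cvgM.
move/cvgrPdist_lt : c2 => /(_ _ e0) c2.
have nD : \forall s \near t, `]- sigma, sigma[%classic s.
  exact: open_nbhs_nbhs.
have /nbhs_ballP[d /= d0 dP] : \forall s \near t,
    `|rnorm (1 - lambda t) ^+ 2 - rnorm (1 - lambda s) ^+ 2| < e /\
    `]- sigma, sigma[%classic s.
  exact: filterI.
exists (d / 2); rewrite ?divr_gt0// => s; rewrite in_itv /= => /andP[ts std].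
have [h1 h2] : `|rnorm (1 - lambda t) ^+ 2 - rnorm (1 - lambda s) ^+ 2| < e /\
    `]- sigma, sigma[%classic s.
  by apply: dP; rewrite /ball /= ltr_norml; apply/andP; split; lra.
rewrite !multiplier_error_in//; last by move: h2; rewrite /= in_itv /= -ltr_norml.
by move: h1; rewrite ltr_norml => /andP[_ h1]; lra.
Unshelve. all: by end_near. Qed.

End multiplier_error.

Section sharp_point.
Variables (R : realType) (H : completeNormedModType R[i]).
Variables (dot : {dot H for Num.conj}).
Hypothesis dot_norm : forall x : H, dot x x = `|x| ^+ 2.
Variables (E : set R -> H -> H).
Hypothesis hE : resolution_of_identity dot E.
Variables (phi : R[i] -> R[i]) (phi_cont : continuous (phi : R[i]^o -> R[i]^o)).
Hypothesis hpsi : class_Phi (psi_of phi).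
Variables (sigma delta : R) (V : R -> R).
Hypothesis delta_gt0 : 0 < delta.
Hypothesis hV : weight V.
Hypothesis E_neq0 : forall t e : R, 0 < e -> exists x : H, E `[t, t + e]%classic x <> 0.
Local Notation psi := (psi_of phi).
Local Notation Gam := (Gamma psi V).

(** On a short interval with end point t both the error and Gamma lose at most e, in the
    unfavourable direction; [sharp_interval] applies and e is arbitrary. *)
Lemma sharp_point lambda c t : multiplier sigma lambda -> t != 0 ->
  (forall x, moved E x -> rnorm (x - multiplier_op E sigma lambda x) ^+ 2 <=
     c * gen_modulus E phi V delta x ^+ 2) ->
  0 <= c /\ multiplier_error sigma lambda t <= c * Gam (delta * t).
Proof.
move=> hl t0 hc.
have key e : 0 < e -> 0 <= c /\
    multiplier_error sigma lambda t - e <= c * (Gam (delta * t) + e).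
  move=> e0.
  (* [sharp_interval] requires a nonnegative lower bound. *)
  pose q := Num.max 0 (multiplier_error sigma lambda t - e).
  have q0 : 0 <= q by rewrite /q le_max lexx.
  have qh : multiplier_error sigma lambda t - e <= q by rewrite /q le_max lexx orbT.
  have hq s : multiplier_error sigma lambda t - e <= multiplier_error sigma lambda s ->
      q <= multiplier_error sigma lambda s.
    by rewrite /q ge_max => ->; rewrite sqr_ge0.
  have cG : (fun s => Gam (delta * s)) @ t --> Gam (delta * t).
    apply: (@continuous_comp R R R ( *%R delta)); first exact: mulrl_continuous.
    exact: Gamma_continuous.
  move/cvgrPdist_lt : cG => /(_ _ e0) /nbhs_ballP[d /= d0 dP].
  have gP s : `|t - s| < d -> Gam (delta * s) <= Gam (delta * t) + e.
    move=> /dP /=; rewrite ltr_norml => /andP[h1 h2]; lra.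
  have t1 : 0 < `|t| by rewrite normr_gt0.
  have [[r r0 rP]|[r r0 rP]] := multiplier_error_near t hl e0.
    (* The bound r controls the error, d / 2 controls Gamma, and |t| / 2 keeps the interval away
       from 0. *)
    pose m := Num.min r (Num.min (d / 2) (`|t| / 2)).
    have m0 : 0 < m by rewrite /m !lt_min r0 !divr_gt0.
    have mr : m <= r by rewrite /m ge_min lexx.
    have md : m <= d / 2 by rewrite /m !ge_min lexx orbT.
    have mt : m <= `|t| / 2 by rewrite /m !ge_min lexx !orbT.
    have [c0 hh] : 0 <= c /\ q <= c * (Gam (delta * t) + e).
      apply: (sharp_interval dot_norm hE phi_cont hpsi delta_gt0 hV
        (a := t) (b := t + m) hl (E_neq0 t m0)) => //.
      - move: t0; rewrite neq_lt => /orP[tn|tp]; [right|by left].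
        by move: mt; rewrite ltr0_norm//; lra.
      - move=> s; rewrite in_itv /= => /andP[s1 s2].
        by apply: hq; apply: rP; rewrite in_itv /= s1/=; lra.
      - move=> s; rewrite in_itv /= => /andP[s1 s2]; apply: gP.
        by rewrite ltr_norml; apply/andP; split; lra.
    by split=> //; exact: le_trans hh.
  pose m := Num.min r (Num.min (d / 2) (`|t| / 2)).
  have m0 : 0 < m by rewrite /m !lt_min r0 !divr_gt0.
  have mr : m <= r by rewrite /m ge_min lexx.
  have md : m <= d / 2 by rewrite /m !ge_min lexx orbT.
  have mt : m <= `|t| / 2 by rewrite /m !ge_min lexx !orbT.
  have Em := E_neq0 (t - m) m0; rewrite subrK in Em.
  have [c0 hh] : 0 <= c /\ q <= c * (Gam (delta * t) + e).
    apply: (sharp_interval dot_norm hE phi_cont hpsi delta_gt0 hV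
      (a := t - m) (b := t) hl Em) => //.
    - move: t0; rewrite neq_lt => /orP[tn|tp]; [by right|left].
      by move: mt; rewrite gtr0_norm//; lra.
    - move=> s; rewrite in_itv /= => /andP[s1 s2].
      by apply: hq; apply: rP; rewrite in_itv /= s2 andbT; lra.
    - move=> s; rewrite in_itv /= => /andP[s1 s2]; apply: gP.
      by rewrite ltr_norml; apply/andP; split; lra.
  by split=> //; exact: le_trans hh.
have [c0 _] := key 1 ltr01; split=> //.
rewrite leNgt; apply/negP => lt_h.
pose eta := multiplier_error sigma lambda t - c * Gam (delta * t).
have eta0 : 0 < eta by rewrite subr_gt0.
have c1 : 0 < 1 + c by rewrite ltr_pwDl.
(* If the inequality fails by eta, this e satisfies (1 + c) e = eta / 2, too small to cover the
   failure. *)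
have [_] := key (eta / (2 * (1 + c))) (divr_gt0 eta0 (mulr_gt0 (ltr0Sn R 1) c1)).
rewrite leNgt => /negP; apply; rewrite mulrDr.
set e := eta / _.
have ee : (1 + c) * e = eta / 2.
  by rewrite /e; field; rewrite lt0r_neq0.
have : c * Gam (delta * t) = multiplier_error sigma lambda t - eta by rewrite /eta; ring.
by move=> ->; move: ee; rewrite mulrDl mul1r; lra.
Qed.

End sharp_point.

(** * Tent-shaped multipliers *)

Section tent_multiplier.
Variable R : realType.

Lemma rnorm_continuous_within (f : R -> R[i]) (D : set R) :
  (forall t, rnorm_continuous_at f t) -> {within D, continuous (f : R -> R[i]^o)}.
Proof.
move=> cf; apply: continuous_subspaceT => t; apply/cvgrPdist_lt => -[e b].
rewrite ltcE /= => /andP[/eqP -> e0]; near=> s.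
by rewrite rnormE ltcR rnormB; near: s; exact: cf.
Unshelve. all: by end_near. Qed.

(* A multiplier with |1 - lambda| of height d at tau and vanishing outside
   [tau / 2, 3 tau / 2]: letting tau tend to 0, where Gamma vanishes, defeats any
   finite constant depending on the deviation d only. *)
Definition tent (d tau s : R) : R[i] :=
  1 - (d * Num.max 0 (1 - `|s - tau| / (tau / 2)))%:C.

Variables (d tau sigma : R).
Hypothesis d_ge0 : 0 <= d.
Hypothesis tau_gt0 : 0 < tau.
Hypothesis tau_lt : tau < sigma.

Let tau2 : 0 < tau / 2. Proof. by rewrite divr_gt0. Qed.

Lemma rnorm_1Btent s :
  rnorm (1 - tent d tau s) = d * Num.max 0 (1 - `|s - tau| / (tau / 2)).
Proof. by rewrite /tent subKr rnorm_real ger0_norm// mulr_ge0// le_max lexx. Qed.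

Lemma rnorm_1Btent_le s : rnorm (1 - tent d tau s) <= d.
Proof.
rewrite rnorm_1Btent ler_piMr// ge_max ler01 gerBl.
by rewrite divr_ge0// ltW.
Qed.

Lemma rnorm_1Btent_tau : rnorm (1 - tent d tau tau) = d.
Proof. by rewrite rnorm_1Btent subrr normr0 mul0r subr0 max_r ?ler01// mulr1. Qed.

Lemma tent_continuous t : rnorm_continuous_at (tent d tau) t.
Proof.
(* The tent is Lipschitz with constant d / (tau / 2); the denominator d + 1 stays positive for d =
   0. *)
move=> e e0; apply/nbhs_ballP; exists (e * (tau / 2) / (d + 1)) => /=.
  by rewrite divr_gt0 ?mulr_gt0// ltr_wpDl.
move=> s; rewrite /ball /= => ts.
have -> : tent d tau s - tent d tau t = (d * (Num.max 0 (1 - `|t - tau| / (tau / 2)) -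
    Num.max 0 (1 - `|s - tau| / (tau / 2))))%:C.
  by rewrite /tent mulrBr rmorphB /=; ring.
rewrite rnorm_real normrM (ger0_norm d_ge0).
have maxL (a b : R) : `|Num.max 0 a - Num.max 0 b| <= `|a - b|.
  have h0 := normr_ge0 (a - b); have h1 := ler_norm (a - b).
  have h2 := ler_norm (b - a); rewrite distrC in h2.
  by rewrite ler_norml; case: (leP 0 a) => ?; case: (leP 0 b) => ?;
    apply/andP; split; lra.
apply: (@le_lt_trans _ _ (d * (`|t - s| / (tau / 2)))).
  rewrite ler_wpM2l// (le_trans (maxL _ _))//.
  have -> : 1 - `|t - tau| / (tau / 2) - (1 - `|s - tau| / (tau / 2)) =
      (`|s - tau| - `|t - tau|) / (tau / 2) by ring.
  rewrite normrM [X in _ * X]ger0_norm ?invr_ge0 ?(ltW tau2)//.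
  rewrite ler_pM2r ?invr_gt0// (le_trans (ler_dist_dist _ _))//.
  by rewrite opprB addrA subrK distrC.
rewrite ltr_pdivlMr in ts; last by rewrite ltr_wpDl.
rewrite mulrA ltr_pdivrMr// (le_lt_trans _ ts)// mulrC ler_wpM2l//.
by rewrite lerDl.
Qed.

Lemma tent_multiplier : multiplier sigma (tent d tau).
Proof.
split.
- by apply: rnorm_continuous_within => t; exact: tent_continuous.
- exists (1 + d) => t _.
  have := rnormBD 1 (tent d tau t) 0; rewrite !subr0 rnorm1 (rnormB (tent d tau t) 1).
  by have := rnorm_1Btent_le t; lra.
- exists (tau / 2); split; [exact: tau2|by move: tau_gt0 tau_lt; lra|].
  move=> t tt; rewrite /tent max_l ?mulr0 ?subr0//.
  rewrite subr_le0 ler_pdivlMr// mul1r.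
  by move: tt; rewrite ltr_norml => /andP[t1 t2]; rewrite ltr0_norm; lra.
Qed.

Lemma deviation_tent : deviation sigma (tent d tau) = d.
Proof.
have ubd : ubound [set rnorm (1 - tent d tau t) | t in `]- sigma, sigma[] d.
  by move=> _ [t _ <-]; exact: rnorm_1Btent_le.
have Ad : [set rnorm (1 - tent d tau t) | t in `]- sigma, sigma[] d.
  exists tau; last exact: rnorm_1Btent_tau.
  by rewrite /= in_itv /= tau_lt andbT; have := tau_gt0; have := tau_lt; lra.
apply/eqP; rewrite eq_le; apply/andP; split.
  by apply: ge_sup => //; exists d.
by apply: ub_le_sup => //; exists d.
Qed.

End tent_multiplier.

Lemma multiplier_cst1 (R : realType) (sigma : R) : 0 < sigma ->
  multiplier sigma (fun=> 1 : R[i]).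
Proof.
move=> s0; split.
- by apply: continuous_subspaceT => t; exact: cvg_cst.
- by exists 1 => t _; rewrite rnorm1.
- by exists (sigma / 2); split => //; [rewrite divr_gt0|lra].
Qed.

(** * Sharpness of the three constants *)

Section conclusions.
Variables (R : realType) (H : completeNormedModType R[i]).
Variables (dot : {dot H for Num.conj}).
Hypothesis dot_norm : forall x : H, dot x x = `|x| ^+ 2.
Variables (E : set R -> H -> H).
Hypothesis hE : resolution_of_identity dot E.
Variables (phi : R[i] -> R[i]) (phi_cont : continuous (phi : R[i]^o -> R[i]^o)).
Hypothesis hpsi : class_Phi (psi_of phi).
Variables (sigma delta : R) (V : R -> R).
Hypothesis sigma_gt0 : 0 < sigma.
Hypothesis delta_gt0 : 0 < delta.
Hypothesis hV : weight V.
Hypothesis E_neq0 : forall t e : R, 0 < e -> exists x : H, E `[t, t + e]%classic x <> 0.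
Local Notation psi := (psi_of phi).
Local Notation Gam := (Gamma psi V).

Let sharp := @sharp_point R H dot dot_norm E hE phi phi_cont hpsi sigma delta V
  delta_gt0 hV E_neq0.

(** This identity makes (B) and its sharpness the case lambda = 1 of the statements on
    multipliers. *)
Lemma best_approx_multiplier x :
  best_approx E sigma x = rnorm (x - multiplier_op E sigma (fun=> 1) x).
Proof.
rewrite (best_approxE dot_norm hE) /multiplier_op (spectral_integral1 dot_norm hE)//.
Qed.

(** Outside the interval the error is 1 whatever lambda is, so a constant valid for any one
    multiplier already dominates [constB]. *)
Lemma sharp_constB lambda c : multiplier sigma lambda ->
  (forall x, moved E x -> rnorm (x - multiplier_op E sigma lambda x) ^+ 2 <=
     c * gen_modulus E phi V delta x ^+ 2) ->
  0 <= c /\ (constB psi V delta sigma <= c%:E)%E.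
Proof.
move=> hl hc; have [c0 _] := sharp hl (lt0r_neq0 sigma_gt0) hc; split => //.
apply: constB_le => // t st.
have t0 : t != 0 by rewrite -normr_gt0 (lt_le_trans sigma_gt0).
by have [_] := sharp hl t0 hc; rewrite multiplier_error_out.
Qed.

Lemma sharp_for_multiplierP lambda : multiplier sigma lambda ->
  sharp_for_multiplier E phi V delta sigma lambda
    (constA_pointwise psi V delta sigma lambda).
Proof.
move=> hl c hc; have [c0 hB] := sharp_constB hl hc.
have l0 : lambda 0 = 1.
  by case: hl => _ _ [e [e0 _ he]]; apply: he; rewrite normr0.
apply: constA_pointwise_finite_le => // t st t0.
by have [_] := sharp hl t0 hc; rewrite multiplier_error_in.
Qed.

Lemma sharp_for_best_approxP :
  sharp_for_best_approx E phi V delta sigma (constB psi V delta sigma).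
Proof.
move=> c hc; have [] // := @sharp_constB (fun=> 1) c (multiplier_cst1 sigma_gt0).
by move=> x /hc; rewrite best_approx_multiplier.
Qed.

(** If lambda = 1 on the interval, only [constB] remains. Otherwise the deviation d is positive and
    no real c is valid: tents of height d at tau would give d^2 <= c Gamma(V; delta tau), which
    tends to 0 with tau. *)
Lemma sharp_for_deviationP lambda : multiplier sigma lambda ->
  sharp_for_deviation E phi V delta sigma lambda (constA psi V delta sigma lambda).
Proof.
move=> hl c hc; have [c0 hB] := sharp_constB hl (hc _ hl erefl).
have [l1|] := pselect (forall t, `|t| < sigma -> rnorm (1 - lambda t) = 0).
  exact: constA_le.
move=> /existsNP[t /not_implyP[st /eqP n0]]; exfalso.
set d := deviation sigma lambda in hc.
have d0 : 0 < d.
  apply: (@lt_le_trans _ _ (rnorm (1 - lambda t))).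
    by rewrite lt_neqAle eq_sym n0 rnorm_ge0.
  apply: ub_le_sup; last by exists t; rewrite //= in_itv /= -ltr_norml.
  have [_ [M MP] _] := hl; exists (1 + M) => _ [s /= ss <-].
  have := rnormD 1 (- lambda s); rewrite rnorm1 rnormN => h.
  by apply: le_trans h _; rewrite lerD2l MP// ltr_norml; move: ss; rewrite in_itv.
have cG : (fun s => Gam (delta * s)) @ (0 : R) --> Gam (delta * 0).
  apply: (@continuous_comp R R R ( *%R delta)); first exact: mulrl_continuous.
  exact: Gamma_continuous.
have c1 : 0 < c + 1 by rewrite ltr_wpDl.
(* Below this threshold (c + 1) Gamma < d^2; the summand 1 allows c = 0. *)
have g0 : 0 < d ^+ 2 / (c + 1) by rewrite divr_gt0// exprn_gt0.
move/cvgrPdist_lt : cG => /(_ _ g0) /nbhs_ballP[r /= r0 rP].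
pose tau := Num.min (r / 2) (sigma / 2).
have tau0 : 0 < tau by rewrite /tau lt_min !divr_gt0.
have taur : tau <= r / 2 by rewrite /tau ge_min lexx.
have taus : tau <= sigma / 2 by rewrite /tau ge_min lexx orbT.
have tau_sigma : tau < sigma by have := sigma_gt0; lra.
have ht := tent_multiplier (ltW d0) tau0 tau_sigma.
have [_] := sharp ht (lt0r_neq0 tau0) (hc _ ht (deviation_tent (ltW d0) tau0 tau_sigma)).
rewrite multiplier_error_in ?ger0_norm ?(ltW tau0)// (rnorm_1Btent_tau _ (ltW d0)).
rewrite leNgt => /negP; apply.
have : `|Gam (delta * 0) - Gam (delta * tau)| < d ^+ 2 / (c + 1).
  by apply: rP; rewrite /ball /= sub0r normrN ger0_norm ?ltW//; lra.
rewrite mulr0 Gamma_at0// sub0r normrN ger0_norm ?Gamma_ge0// ltr_pdivlMr//.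
have : 0 <= Gam (delta * tau) by exact: Gamma_ge0.
by rewrite mulrDr mulr1 mulrC; lra.
Qed.

End conclusions.

Theorem mainTheorem4 (R : realType) (H : completeNormedModType R[i])
    (dot : {dot H for Num.conj}) (dot_norm : forall x : H, dot x x = `|x| ^+ 2)
    (E : set R -> H -> H) (hE : resolution_of_identity dot E)
    (phi : R[i] -> R[i]) (phi_cont : continuous (phi : R[i]^o -> R[i]^o))
    (hpsi : class_Phi (psi_of phi))
    (sigma delta : R) (sigma_gt0 : 0 < sigma) (delta_gt0 : 0 < delta)
    (V : R -> R) (hV : weight V)
    (lambda : R -> R[i]) (hlambda : multiplier sigma lambda) :
  (forall x : H, moved E x ->
    [/\ ((rnorm (x - multiplier_op E sigma lambda x) ^+ 2)%:E <=
           constA (psi_of phi) V delta sigma lambda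
             * (gen_modulus E phi V delta x ^+ 2)%:E)%E,
        ((rnorm (x - multiplier_op E sigma lambda x) ^+ 2)%:E <=
           constA_pointwise (psi_of phi) V delta sigma lambda
             * (gen_modulus E phi V delta x ^+ 2)%:E)%E,
        best_approx E sigma x ^+ 2 =
          rnorm (x - spectral_integral E `]- sigma, sigma[ (fun=> 1) x) ^+ 2 &
        ((best_approx E sigma x ^+ 2)%:E <=
           constB (psi_of phi) V delta sigma
             * (gen_modulus E phi V delta x ^+ 2)%:E)%E]) /\
  ((forall t e : R, 0 < e -> exists x : H, E `[t, t + e]%classic x <> 0) ->
    [/\ sharp_for_deviation E phi V delta sigma lambda
          (constA (psi_of phi) V delta sigma lambda),
        sharp_for_multiplier E phi V delta sigma lambda
          (constA_pointwise (psi_of phi) V delta sigma lambda) &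
        sharp_for_best_approx E phi V delta sigma
          (constB (psi_of phi) V delta sigma)]).
Proof.
split=> [x mx|E_neq0]; last first.
  split; [exact: sharp_for_deviationP|exact: sharp_for_multiplierP|].
  exact: sharp_for_best_approxP.
have l0 : lambda 0 = 1.
  by case: hlambda => _ _ [e [e0 _ he]]; apply: he; rewrite normr0.
(* The pointwise form is the stronger one; (A) with [constA] follows by monotonicity. *)
have pw : ((rnorm (x - multiplier_op E sigma lambda x) ^+ 2)%:E <=
    constA_pointwise (psi_of phi) V delta sigma lambda *
    (gen_modulus E phi V delta x ^+ 2)%:E)%E.
  apply: (multiplier_inequality dot_norm hE) => // [t st|].
    exact: constA_pointwise_mul.
  exact: constB_constA_pointwise.
split => //.
- apply: le_trans pw _; apply: lee_wpmul2r; first by rewrite lee_fin sqr_ge0.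
  exact: constA_pointwise_le.
- by rewrite (best_approx_multiplier dot_norm hE).
(* For lambda = 1 the error inside the interval is 0, so [constB] alone suffices as constant. *)
rewrite (best_approx_multiplier dot_norm hE).
apply: (multiplier_inequality dot_norm hE) => //; first exact: multiplier_cst1.
move=> t st; rewrite subrr rnorm0 expr0n mule_ge0 ?lee_fin ?Gamma_ge0//.
exact: constB_ge0.
Qed.
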